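(* Let $Y$ be a connected hypergraph and let $\pi:Y\to X$ be a free Galois covering of hypergraphs with Galois group $G$. (1) Let $\widehat{G}$ be a complete set of inequivalent irreducible representations of $G$. Then $$\zeta_Y(u)=\prod_{\rho\in\widehat{G}}L(u,\rho,Y/X)^{d_\rho},$$ where $d_\rho$ is the dimension of $\rho$. (2) Let $\rho_G$ be the right regular representation of $G$. Then $$L(u,\rho_G,Y/X)=\zeta_Y(u).$$
   Context: **Hypergraphs.** A hypergraph $H$ consists of a nonempty finite set $V(H)$ of vertices and a finite multiset $E(H)$ of nonempty subsets of $V(H)$ (edges; repeated edges are allowed and count as different elements of $E(H)$) with $\bigcup_{e\in E(H)}e=V(H)$. A morphism $\varphi:H_1\to H_2$ is a pair of maps $\varphi_V:V(H_1)\to V(H_2)$, $\varphi_E:E(H_1)\to E(H_2)$ such that $v\in e$ implies $\varphi_V(v)\in\varphi_E(e)$. Isomorphisms and automorphisms are the invertible morphisms. $B_H$ is the simple bipartite graph with vertex set $V(H)\sqcup E(H)$ in which $v\in V(H)$ and $e\in E(H)$ are joined exactly when $v\in e$. **Free actions, quotients, Galois coverings.** An action of a group $G$ on a hypergraph $H$ is a homomorphism $G\to\mathrm{Aut}(H)$. It is free if (a) $G$ acts freely on $V(H)$ and on $E(H)$, and (b) whenever $v\in e$, one has $g(v)\notin e$ for all $g\ne \mathrm{id}_G$. The quotient $H/G$ has vertices $V(H)/G$ and edges $E(H)/G$, where the orbit $[e]$ is identified with the set $\{[v]: v\in e\}$ (different orbits count as different edges); $H\to H/G$ is the orbit map. A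 free Galois covering with Galois group $G$ is a morphism $\pi:Y\to X$ such that $G$ acts freely on $Y$, $X$ is isomorphic to $Y/G$ with $\pi$ becoming the projection, and $G$ is isomorphic to $\{\sigma\in\mathrm{Aut}(Y):\pi\circ\sigma=\pi\}$. **Cycles.** A path of length $n$ in $H$ is a sequence $(v_0,e_1,v_1,\dots,e_n,v_n)$ with $v_{i-1},v_i\in e_i$. $H$ is connected if any two vertices are joined by a path. A cycle (closed path) is a path with $n>1$ and $v_0=v_n$. A path has edge-backtracking if it contains a subsequence $(e,v,e)$ of consecutive entries. $C^k$ is the cycle going $k$ times around $C$; $C$ has no tail if $C^2$ has no edge-backtracking. A prime cycle is a cycle with consecutive vertices distinct ($v_{i-1}\ne v_i$ for all $i$), without edge-backtracking and without tail, that is not of the form $D^k$ for any cycle $D$ and $k>1$. Two prime cycles are equivalent if they differ by a cyclic change of starting vertex; $[C]$ is the class, $\ell(C)$ the length. **Zeta function.** $\zeta_H(u)=\prod_{[C]}(1-u^{\ell(C)})^{-1}$, over equivalence classes of prime cycles of $H$. **Frobenius elements.** Let $G$ act freely on a connected hypergraph $Y$, $X=Y/G$, with projection $\pi$. A lift of a path $P$ of $X$ is a path $P'$ in $Y$ with $\pi(P')=P$; there is a unique lift with any prescribed initial vertex over the initial vertex of $P$. Fix a spanning tree $T$ of $B_X$, $v_0\in V(X)$ and $v_0'\in V(Y)$ with $\pi(v_0')=v_0$. For $w\in V(X)$ let $P_w$ be the path in $X$ from $v_0$ to $w$ whose associated path in $B_X$ is the simple path in $T$ from $v_0$ to $w$,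 and let $P_w'$ be its lift starting at $v_0'$. The sheet $\mathrm{id}_G$ is the set of terminal vertices of all $P'_w$; the sheet number of $v\in V(Y)$ is the unique $g\in G$ with $v=g(s)$ for some $s$ in sheet $\mathrm{id}_G$. For a closed path $C$ of $X$, $F(C,Y/X)\in G$ is the sheet number of the terminal vertex of the unique lift of $C$ whose initial vertex is in sheet $\mathrm{id}_G$. Up to conjugacy it is independent of the choices and of the representative of $[C]$. **$L$-function.** For a representation $\rho$ of $G$ (finite-dimensional, complex), $$L(u,\rho,Y/X)=\prod_{[C]}\det\bigl(1-\rho(F(C,Y/X))u^{\ell(C)}\bigr)^{-1},$$ the product over equivalence classes of prime cycles of $X$. Infinite products are understood as formal power series in $u$. *)

(* Defs.v *)
From HB Require Import structures.
From mathcomp Require Import all_boot all_order all_algebra all_fingroup.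
From mathcomp Require Import mxrepresentation.
From mathcomp Require Import boolp reals complex.

Set Implicit Arguments.
Unset Strict Implicit.
Unset Printing Implicit Defensive.

Import GRing.Theory.

Local Open Scope ring_scope.

Record fps (K : Type) := Fps { coef_fps :> nat -> K }.

Lemma fpsP (K : Type) (f g : fps K) : (forall n, f n = g n) -> f = g.
Proof. by case: f g => [f] [g] /= /funext ->. Qed.

Lemma coef_fpsK (K : Type) : cancel (@coef_fps K) (@Fps K).
Proof. by case. Qed.

HB.instance Definition _ (K : choiceType) :=
  Choice.copy (fps K) (can_type (@coef_fpsK K)).

Definition fps0 (K : fieldType) : fps K := Fps (fun=> 0).
Definition fpsC (K : fieldType) (c : K) : fps K :=
  Fps (fun n => if n == 0%N then c else 0).
Definition fpsX (K : fieldType) : fps K := Fps (fun n => (n == 1%N)%:R).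
Definition fps_opp (K : fieldType) (f : fps K) : fps K := Fps (fun n => - f n).
Definition fps_add (K : fieldType) (f g : fps K) : fps K :=
  Fps (fun n => f n + g n).
Definition fps_mul (K : fieldType) (f g : fps K) : fps K :=
  Fps (fun n => \sum_(i < n.+1) f i * g (n - i)%N).

Fact fps_addA (K : fieldType) : associative (@fps_add K).
Proof. by move=> f g h; apply: fpsP => n /=; rewrite addrA. Qed.

Fact fps_addC (K : fieldType) : commutative (@fps_add K).
Proof. by move=> f g; apply: fpsP => n /=; rewrite addrC. Qed.

Fact fps_add0 (K : fieldType) : left_id (@fps0 K) (@fps_add K).
Proof. by move=> f; apply: fpsP => n /=; rewrite add0r. Qed.

Fact fps_addN (K : fieldType) :
  left_inverse (@fps0 K) (@fps_opp K) (@fps_add K).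
Proof. by move=> f; apply: fpsP => n /=; rewrite addNr. Qed.

HB.instance Definition _ (K : fieldType) := GRing.isZmodule.Build (fps K)
  (@fps_addA K) (@fps_addC K) (@fps_add0 K) (@fps_addN K).

Definition fps_trunc (K : fieldType) (n : nat) (f : fps K) : {poly K} :=
  \poly_(i < n.+1) f i.

Fact fps_mul_trunc (K : fieldType) (f g : fps K) (m n : nat) :
  (m <= n)%N -> fps_mul f g m = (fps_trunc n f * fps_trunc n g)`_m.
Proof.
move=> le_mn; rewrite coefM; apply: eq_bigr => i _; rewrite !coef_poly !ltnS.
by rewrite (leq_trans (leq_ord i) le_mn) (leq_trans (leq_subr i m) le_mn).
Qed.

Fact fps_mulC (K : fieldType) : commutative (@fps_mul K).
Proof.
by move=> f g; apply: fpsP => n; rewrite !(@fps_mul_trunc _ _ _ n n) // mulrC.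
Qed.

Fact fps_mulA (K : fieldType) : associative (@fps_mul K).
Proof.
move=> f g h; apply: fpsP => n.
transitivity ((fps_trunc n f * (fps_trunc n g * fps_trunc n h))`_n).
  rewrite coefM /=; apply: eq_bigr => i _.
  rewrite -[X in _ * X]/(fps_mul g h (n - i)%N).
  rewrite (@fps_mul_trunc _ _ _ _ n) ?leq_subr //.
  by rewrite coef_poly ltnS leq_ord.
rewrite mulrA coefM /=; apply: eq_bigr => i _.
rewrite -(@fps_mul_trunc _ f g _ n) ?leq_ord //.
by rewrite coef_poly ltnS leq_subr.
Qed.

Fact fps_mul1 (K : fieldType) : left_id (fpsC (1 : K)) (@fps_mul K).
Proof.
move=> f; apply: fpsP => n; rewrite /= big_ord_recl /= mul1r subn0.
by rewrite big1 ?addr0 // => i _; rewrite mul0r.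
Qed.

Fact fps_mulDl (K : fieldType) : left_distributive (@fps_mul K) (@fps_add K).
Proof.
move=> f g h; apply: fpsP => n; rewrite /= -big_split /=.
by apply: eq_bigr => i _; rewrite mulrDl.
Qed.

Fact fps_1neq0 (K : fieldType) : fpsC (1 : K) != 0.
Proof.
apply/eqP => /(congr1 (fun f : fps K => f 0%N)) /= /eqP.
by rewrite oner_eq0.
Qed.

HB.instance Definition _ (K : fieldType) :=
  GRing.Zmodule_isComNzRing.Build (fps K)
    (@fps_mulA K) (@fps_mulC K) (@fps_mul1 K) (@fps_mulDl K) (@fps_1neq0 K).

Lemma coef_fpsM (K : fieldType) (f g : fps K) (n : nat) :
  (f * g) n = \sum_(i < n.+1) f i * g (n - i)%N.
Proof. by []. Qed.

Lemma coef_fps_sum (K : fieldType) (I : Type) (r : seq I) (P : pred I)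
    (F : I -> fps K) (n : nat) :
  (\sum_(i <- r | P i) F i) n = \sum_(i <- r | P i) F i n.
Proof. by elim/big_rec2: _ => //= i x y _ <-. Qed.

(* The coefficients of the inverse of [c - c * h], where [h] has no constant
   term, are those of [c^-1 * \sum_k h ^+ k]; the powers [h ^+ k] with [k > n]
   do not contribute to the coefficient of [u ^ n]. *)
Definition fps_inv (K : fieldType) (f : fps K) : fps K :=
  if f 0%N == 0 then f else
  let c := (f 0%N)^-1 in
  fpsC c * Fps (fun n => (\sum_(k < n.+1) (1 - fpsC c * f) ^+ k) n).

Lemma coef_fpsX_lt (K : fieldType) (h : fps K) (k n : nat) :
  h 0%N = 0 -> (n < k)%N -> (h ^+ k) n = 0.
Proof.
move=> h0; elim: k n => // k IHk n lt_nk.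
rewrite exprS coef_fpsM big1 // => -[[|i] /= ltin] _; first by rewrite h0 mul0r.
rewrite IHk ?mulr0 // ltn_subLR //.
by rewrite addSn ltnS (leq_trans _ (leq_addl _ _)) // -ltnS.
Qed.

Lemma fps_mulVf (K : fieldType) (f : fps K) :
  f 0%N != 0 -> fps_inv f * f = 1.
Proof.
move=> f0; rewrite /fps_inv (negPf f0); set c := (f 0%N)^-1.
set h := 1 - fpsC c * f; set S := Fps _.
have h0 : h 0%N = 0.
  rewrite -[h 0%N]/(1 - (fpsC c * f) 0%N) coef_fpsM big_ord_recl big_ord0 /=.
  by rewrite addr0 mulVf // subrr.
have -> : fpsC c * S * f = S * (1 - h).
  by rewrite /h opprB addrCA subrr addr0 mulrAC mulrC.
apply: fpsP => n.
have -> : (S * (1 - h)) n = ((\sum_(k < n.+1) h ^+ k) * (1 - h)) n.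
  rewrite !coef_fpsM; apply: eq_bigr => i _; congr (_ * _).
  rewrite [LHS]/= !coef_fps_sum.
  rewrite (big_ord_widen_cond n.+1 predT (fun k => (h ^+ k) i)) ?ltn_ord //=.
  rewrite [RHS](bigID (fun k : 'I_n.+1 => (k < i.+1)%N)) /=.
  rewrite [X in _ + X]big1 ?addr0 // => k; rewrite -leqNgt => ltik.
  exact: coef_fpsX_lt.
have -> : (\sum_(k < n.+1) h ^+ k) * (1 - h) = 1 - h ^+ n.+1.
  by rewrite mulrC -opprB mulNr -subrX1 opprB.
by rewrite -[LHS]/((1 : fps K) n - (h ^+ n.+1) n) coef_fpsX_lt // subr0.
Qed.

Fact fps_mulV (K : fieldType) :
  {in (fun f : fps K => f 0%N != 0), left_inverse 1 (@fps_inv K) *%R}.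
Proof. by move=> f; apply: fps_mulVf. Qed.

Fact fps_unitPl (K : fieldType) (f g : fps K) : g * f = 1 -> f 0%N != 0.
Proof.
move=> gf1; apply/eqP => f0; have := congr1 (fun f : fps K => f 0%N) gf1.
rewrite coef_fpsM big_ord_recl big_ord0 /= f0 mulr0 addr0 => /esym/eqP.
by rewrite oner_eq0.
Qed.

Fact fps_inv_out (K : fieldType) :
  {in [predC (fun f : fps K => f 0%N != 0)], @fps_inv K =1 id}.
Proof. by move=> f; rewrite inE negbK /fps_inv => ->. Qed.

HB.instance Definition _ (K : fieldType) :=
  GRing.ComNzRing_hasMulInverse.Build (fps K)
    (@fps_mulV K) (@fps_unitPl K) (@fps_inv_out K).

(* The infinite product [\prod_l P l] for factors [P l = 1 + O(u ^ l)]: the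
   coefficient of [u ^ n] is that of any partial product over [l < N] with
   [n < N]; see [fps_prodE]. *)
Definition fps_prod (K : fieldType) (P : nat -> fps K) : fps K :=
  Fps (fun n => (\prod_(l < n.+1) P l) n).

Lemma fps_prodE (K : fieldType) (P : nat -> fps K) (n N : nat) :
  (forall l m : nat, (m < l)%N -> P l m = (1 : fps K) m) ->
  (n < N)%N -> fps_prod P n = (\prod_(l < N) P l) n.
Proof.
move=> P1; rewrite [LHS]/=; elim: N => // N IHN; rewrite ltnS leq_eqVlt.
case/predU1P=> [-> //|lt_nN]; rewrite {}IHN // [in RHS]big_ord_recr coef_fpsM.
rewrite [RHS]big_ord_recr /= subnn [X in X + _]big1 ?add0r; last first.
  move=> i _; rewrite P1; last exact: leq_ltn_trans (leq_subr _ _) lt_nN.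
  by rewrite /= subn_eq0 leqNgt ltn_ord mulr0.
by rewrite P1 ?(leq_ltn_trans _ lt_nN) //= mulr1.
Qed.

(* A finite multiset of vertex sets is a finite type of edges together with a
   (not necessarily injective) map to sets of vertices. *)
Record hypergraph := Hypergraph {
  vert : finType;
  edge : finType;
  eset : edge -> {set vert};
  vert_nonempty : (0 < #|vert|)%N;
  eset_nonempty : forall e, eset e != set0;
  eset_cover : \bigcup_e eset e = [set: vert] }.

Record hmor (H1 H2 : hypergraph) := Hmor {
  mV : vert H1 -> vert H2;
  mE : edge H1 -> edge H2;
  mor_inc : forall v e, v \in eset e -> mV v \in eset (mE e) }.

Definition is_iso (H1 H2 : hypergraph) (f : hmor H1 H2) : Prop :=
  exists g : hmor H2 H1,
    [/\ cancel (mV f) (mV g), cancel (mV g) (mV f),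
        cancel (mE f) (mE g) & cancel (mE g) (mE f)].

(* Pairs of bijections that are morphisms together with their inverses.  The
   product of permutations composes from left to right. *)
Definition haut (H : hypergraph) : {set {perm vert H} * {perm edge H}} :=
  [set s : {perm vert H} * {perm edge H}
    | [forall v, forall e, (s.1 v \in eset (s.2 e)) == (v \in eset e)]].

Definition deck (Y X : hypergraph) (pi : hmor Y X) :
    {set {perm vert Y} * {perm edge Y}} :=
  [set s : {perm vert Y} * {perm edge Y} in haut Y
    | [forall v, mV pi (s.1 v) == mV pi v]
      && [forall e, mE pi (s.2 e) == mE pi e]].

Fact haut_group_set (H : hypergraph) : group_set (haut H).
Proof.
apply/group_setP; split=> [|s t]; rewrite !inE.
  by apply/forallP => v; apply/forallP => e; rewrite !perm1.
move=> /forallP autS /forallP autT; apply/forallP => v; apply/forallP => e.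
rewrite !permM (eqP (forallP (autT _) _)).
exact: forallP (autS v) e.
Qed.
Canonical haut_group (H : hypergraph) := group (@haut_group_set H).

Fact deck_group_set (Y X : hypergraph) (pi : hmor Y X) : group_set (deck pi).
Proof.
apply/group_setP; split=> [|s t].
  rewrite inE group1 /=.
  by apply/andP; split; apply/forallP => x; rewrite perm1.
rewrite !inE => /and3P[autS sV sE] /and3P[autT tV tE].
have := @groupM _ (haut_group Y) s t; rewrite !inE => ->//=.
apply/andP; split; apply/forallP => x; rewrite permM.
  by rewrite (eqP (forallP tV _)) (eqP (forallP sV _)).
by rewrite (eqP (forallP tE _)) (eqP (forallP sE _)).
Qed.
Canonical deck_group (Y X : hypergraph) (pi : hmor Y X) :=
  group (@deck_group_set Y X pi).

(* A homomorphism from the group to the automorphism group, acting on the left: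
   [actV (g * h) = actV g \o actV h]. *)
Record haction (gT : finGroupType) (H : hypergraph) := Haction {
  actV : gT -> vert H -> vert H;
  actE : gT -> edge H -> edge H;
  actV1 : forall v, actV 1%g v = v;
  actE1 : forall e, actE 1%g e = e;
  actVM : forall g h v, actV (g * h)%g v = actV g (actV h v);
  actEM : forall g h e, actE (g * h)%g e = actE g (actE h e);
  act_inc : forall g v e, v \in eset e -> actV g v \in eset (actE g e) }.

Definition free_action (gT : finGroupType) (H : hypergraph)
    (a : haction gT H) : Prop :=
  [/\ forall g v, actV a g v = v -> g = 1%g,
      forall g e, actE a g e = e -> g = 1%g
    & forall g v e, v \in eset e -> g <> 1%g -> actV a g v \notin eset e].

Definition vorbit (gT : finGroupType) (H : hypergraph) (a : haction gT H)
    (v : vert H) : {set vert H} := [set actV a g v | g : gT].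
Definition eorbit (gT : finGroupType) (H : hypergraph) (a : haction gT H)
    (e : edge H) : {set edge H} := [set actE a g e | g : gT].

Definition qvert (gT : finGroupType) (H : hypergraph) (a : haction gT H) :
    finType :=
  {o : {set vert H} | [exists v, o == vorbit a v]}.
Definition qedge (gT : finGroupType) (H : hypergraph) (a : haction gT H) :
    finType :=
  {o : {set edge H} | [exists e, o == eorbit a e]}.

Fact vorbit_proof (gT : finGroupType) (H : hypergraph) (a : haction gT H)
  (v : vert H) : [exists w, vorbit a v == vorbit a w].
Proof. by apply/existsP; exists v. Qed.
Fact eorbit_proof (gT : finGroupType) (H : hypergraph) (a : haction gT H)
  (e : edge H) : [exists f, eorbit a e == eorbit a f].
Proof. by apply/existsP; exists e. Qed.

Definition qprojV (gT : finGroupType) (H : hypergraph) (a : haction gT H)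
  (v : vert H) : qvert a := exist _ (vorbit a v) (vorbit_proof a v).
Definition qprojE (gT : finGroupType) (H : hypergraph) (a : haction gT H)
  (e : edge H) : qedge a := exist _ (eorbit a e) (eorbit_proof a e).

(* The orbits of the vertices of all members of the edge orbit; it does not
   depend on the member, see [qesetE]. *)
Definition qeset (gT : finGroupType) (H : hypergraph) (a : haction gT H)
    (o : qedge a) : {set qvert a} :=
  [set qprojV a v | v in \bigcup_(e in val o) eset e].

Lemma qprojV_act (gT : finGroupType) (H : hypergraph) (a : haction gT H)
  (g : gT) (v : vert H) : qprojV a (actV a g v) = qprojV a v.
Proof.
apply: val_inj => /=; apply/setP => w; apply/imsetP/imsetP => -[h _ ->].
  by exists (h * g)%g; rewrite // actVM.
by exists (h * g^-1)%g; rewrite // -actVM mulgKV.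
Qed.

Lemma qesetE (gT : finGroupType) (H : hypergraph) (a : haction gT H)
  (e : edge H) : qeset (qprojE a e) = [set qprojV a v | v in eset e].
Proof.
apply/setP => w; apply/imsetP/imsetP => -[v vP ->]; last first.
  exists v => //; apply/bigcupP; exists e => //.
  by apply/imsetP; exists 1%g; rewrite // actE1.
have [_ /imsetP[g _ ->] vge] := bigcupP vP.
exists (actV a g^-1%g v); last by rewrite qprojV_act.
by have := act_inc a g^-1%g vge; rewrite -actEM mulVg actE1.
Qed.

Lemma qprojV_surj (gT : finGroupType) (H : hypergraph) (a : haction gT H)
  (o : qvert a) : exists v, o = qprojV a v.
Proof.
by case: o => o oP; have [v /eqP ov] := existsP oP; exists v; apply: val_inj.
Qed.

Lemma qprojE_surj (gT : finGroupType) (H : hypergraph) (a : haction gT H)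
  (o : qedge a) : exists e, o = qprojE a e.
Proof.
by case: o => o oP; have [e /eqP oe] := existsP oP; exists e; apply: val_inj.
Qed.

Fact qvert_nonempty (gT : finGroupType) (H : hypergraph) (a : haction gT H) :
  (0 < #|qvert a|)%N.
Proof.
have /card_gt0P[v _] := vert_nonempty H.
by apply/card_gt0P; exists (qprojV a v).
Qed.

Fact qeset_nonempty (gT : finGroupType) (H : hypergraph) (a : haction gT H)
  (o : qedge a) : qeset o != set0.
Proof.
have [e ->] := qprojE_surj o; have /set0Pn[v ve] := eset_nonempty e.
by apply/set0Pn; exists (qprojV a v); rewrite qesetE imset_f.
Qed.

Fact qeset_cover (gT : finGroupType) (H : hypergraph) (a : haction gT H) :
  \bigcup_o qeset o = [set: qvert a].
Proof.
apply/setP => w; rewrite inE; have [v ->] := qprojV_surj w.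
have : v \in \bigcup_e eset e by rewrite eset_cover.
case/bigcupP=> e _ ve; apply/bigcupP; exists (qprojE a e) => //.
by rewrite qesetE imset_f.
Qed.

Definition quotient_hypergraph (gT : finGroupType) (H : hypergraph)
    (a : haction gT H) : hypergraph :=
  Hypergraph (qvert_nonempty a) (@qeset_nonempty _ _ a) (qeset_cover a).

Definition is_free_galois_covering (gT : finGroupType) (Y X : hypergraph)
    (a : haction gT Y) (pi : hmor Y X) : Prop :=
  [/\ free_action a,
      exists theta : hmor X (quotient_hypergraph a),
        [/\ is_iso theta,
            forall v, mV theta (mV pi v) = qprojV a v
          & forall e, mE theta (mE pi e) = qprojE a e]
    & [set: gT] \isog deck pi].

(* [(v_0, [:: (e_1, v_1); ...; (e_n, v_n)])] *)
Definition walk (H : hypergraph) : Type :=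
  (vert H * seq (edge H * vert H))%type.

Definition source (H : hypergraph) (P : walk H) : vert H := P.1.
Definition target (H : hypergraph) (P : walk H) : vert H :=
  last P.1 (unzip2 P.2).

Fixpoint is_path_from (H : hypergraph) (v : vert H)
    (s : seq (edge H * vert H)) : bool :=
  if s is (e, w) :: s' then
    [&& v \in eset e, w \in eset e & is_path_from w s']
  else true.

Definition is_path (H : hypergraph) (P : walk H) : bool :=
  is_path_from P.1 P.2.

Definition connected (H : hypergraph) : Prop :=
  forall v w : vert H,
    exists P : walk H, [/\ is_path P, source P = v & target P = w].

Definition is_cycle (H : hypergraph) (C : walk H) : bool :=
  [&& is_path C, (1 < size C.2)%N & source C == target C].

Definition edge_backtracking (H : hypergraph) (P : walk H) : bool :=
  ~~ sorted (fun e f => e != f) (unzip1 P.2).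

Definition cycle_pow (H : hypergraph) (C : walk H) (k : nat) : walk H :=
  (C.1, flatten (nseq k C.2)).

Definition has_tail (H : hypergraph) (C : walk H) : bool :=
  edge_backtracking (cycle_pow C 2).

Definition prime_cycle (H : hypergraph) (C : walk H) : Prop :=
  [/\ is_cycle C,
      path (fun v w => v != w) C.1 (unzip2 C.2),
      ~~ edge_backtracking C,
      ~~ has_tail C
    & forall (D : walk H) (k : nat),
        is_cycle D -> (1 < k)%N -> C <> cycle_pow D k].

Definition shift_start (H : hypergraph) (k : nat) (C : walk H) : walk H :=
  (last C.1 (unzip2 (take k C.2)), rot k C.2).

Definition equiv_cycle (H : hypergraph) (C D : walk H) : Prop :=
  exists2 k, (k <= size C.2)%N & D = shift_start k C.

Definition lwalk (H : hypergraph) (l : nat) : finType :=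
  (vert H * l.-tuple (edge H * vert H))%type.

Definition walk_of (H : hypergraph) (l : nat) (C : lwalk H l) : walk H :=
  (C.1, val C.2).

Definition prime_cycles (H : hypergraph) (l : nat) : {set lwalk H l} :=
  [set C | `[< prime_cycle (walk_of C) >]].

Definition prime_classes (H : hypergraph) (l : nat) : {set {set lwalk H l}} :=
  equivalence_partition
    (fun C D => `[< equiv_cycle (walk_of C) (walk_of D) >]) (prime_cycles H l).

Definition zeta (K : fieldType) (H : hypergraph) : fps K :=
  fps_prod (fun l => \prod_(c in prime_classes H l) (1 - fpsX K ^+ l)^-1).

Definition bip_graph (H : hypergraph) : rel (vert H + edge H) :=
  fun x y => match x, y with
             | inl v, inr e | inr e, inl v => v \in eset e
             | _, _ => false
             end.

(* A subgraph on all vertices that is connected and has no cycle of three or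
   more distinct vertices. *)
Definition spanning_tree (H : hypergraph) (T : rel (vert H + edge H)) : Prop :=
  [/\ symmetric T, subrel T (@bip_graph H), forall x y, connect T x y
    & forall c, ucycle T c -> (size c <= 2)%N].

Definition bip_walk (H : hypergraph) (P : walk H) : seq (vert H + edge H) :=
  flatten [seq [:: inr ev.1; inl ev.2] | ev <- P.2].

Definition is_tree_path (H : hypergraph) (T : rel (vert H + edge H))
    (P : walk H) : bool :=
  [&& is_path P, path T (inl P.1) (bip_walk P)
    & uniq (inl P.1 :: bip_walk P)].

Definition map_walk (Y X : hypergraph) (pi : hmor Y X) (P : walk Y) : walk X :=
  (mV pi P.1, [seq (mE pi ev.1, mV pi ev.2) | ev <- P.2]).

Definition is_lift (Y X : hypergraph) (pi : hmor Y X) (P : walk X)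
    (P' : walk Y) : Prop :=
  is_path P' /\ map_walk pi P' = P.

(* The base vertex of [X] is [mV pi y0]. *)
Definition sheet_id (Y X : hypergraph) (pi : hmor Y X)
    (T : rel (vert X + edge X)) (y0 : vert Y) : {set vert Y} :=
  [set y | `[< exists (P : walk X) (P' : walk Y),
                 [/\ is_tree_path T P, source P = mV pi y0, is_lift pi P P',
                     source P' = y0 & target P' = y] >]].

(* The default value [1] is not used for a free covering of a connected
   hypergraph and a spanning tree [T]: the sheet number exists and is unique. *)
Definition sheet_number (gT : finGroupType) (Y X : hypergraph)
    (a : haction gT Y) (pi : hmor Y X) (T : rel (vert X + edge X))
    (y0 : vert Y) (y : vert Y) : gT :=
  odflt 1%g [pick g | [exists s in sheet_id pi T y0, y == actV a g s]].

(* Likewise, a closed path has a unique lift starting in the sheet of the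
   identity. *)
Definition frobenius (gT : finGroupType) (Y X : hypergraph)
    (a : haction gT Y) (pi : hmor Y X) (T : rel (vert X + edge X))
    (y0 : vert Y) (C : walk X) : gT :=
  odflt 1%g [pick g | `[< exists C' : walk Y,
    [/\ is_lift pi C C', source C' \in sheet_id pi T y0
      & sheet_number a pi T y0 (target C') = g] >]].

(* Each class is represented by its element in a transversal; the determinant
   does not depend on it, the Frobenius elements of equivalent cycles being
   conjugate. *)
Definition Lfun (K : fieldType) (gT : finGroupType) (Y X : hypergraph)
    (a : haction gT Y) (pi : hmor Y X) (T : rel (vert X + edge X))
    (y0 : vert Y) (n : nat) (rho : mx_representation K [set: gT] n) : fps K :=
  fps_prod (fun l =>
    \prod_(C in transversal (prime_classes X l) (prime_cycles X l))
      (\det (1%:M - fpsX K ^+ l *: map_mx (@fpsC K)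
               (rho (frobenius a pi T y0 (walk_of C)))))^-1).

Definition complete_irreducibles (K : fieldType) (gT : finGroupType)
    (I : finType) (d : I -> nat)
    (rho : forall i, mx_representation K [set: gT] (d i)) : Prop :=
  [/\ forall i, mx_irreducible (rho i),
      forall i j, mx_rsim (rho i) (rho j) -> i = j
    & forall n (sigma : mx_representation K [set: gT] n),
        mx_irreducible sigma -> exists i, mx_rsim sigma (rho i)].

(* Main.v *)
Require Import Defs.
From HB Require Import structures.
From mathcomp Require Import all_boot all_order all_algebra all_fingroup.
From mathcomp Require Import mxrepresentation.
From mathcomp Require Import boolp reals complex.

(** Both sides of each identity are power series with constant term [1] over a
    field of characteristic [0], so they are equal as soon as their logarithmic
    derivatives [u f' / f] are ([has_logder_inj]).  Taking logarithmic
    derivatives turns the infinite products into sums of traces: a factor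
    [det (1 - A u^l)^-1] contributes [l * tr (A^k)] to the coefficient of
    [u^(l k)] ([has_logder_det_inv], from Jacobi's formula for the derivative of
    a determinant).

    Call a closed path reduced if it has distinct consecutive vertices, no
    edge-backtracking and no tail.  Seen as a cyclic word in pairs (edge,
    vertex), such a path is a closed walk for the relation [step], and the prime
    cycles are the primitive words.  Every word is a power [t^k] of a unique
    primitive word [t], and a primitive word of length [l] has exactly [l]
    rotations; hence summing [l * w (C^k)] over the classes of prime cycles [C]
    with [l k = m] is the same as summing [w] over all reduced closed paths of
    length [m] ([sum_cyclic_words]).  In particular the coefficient of [u^m] in
    the logarithmic derivative of [zeta_Y] is the number of reduced closed paths
    of length [m] in [Y] ([has_logder_zeta]).

    For [L (u, rho, Y/X)] that coefficient is the sum of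
    [l * tr (rho (F(C)^k))].  The regular representation has trace [|G|] at the
    identity and [0] elsewhere, and it has the same trace as the sum of the
    irreducible representations, each repeated as often as its dimension.  So
    both parts of the theorem reduce to one count: among the lifts of [C^k] to
    [Y], all [|G|] of them are closed if [F(C)^k = 1] and none is otherwise
    ([card_closed_lifts]), because the lift starting at [s] in the sheet of the
    identity ends at [F(C)^k s] and [G] translates lifts.  A reduced closed path
    of [Y] projects to a reduced closed path of [X], and conversely closed lifts
    of reduced paths are reduced, so adding up these counts gives the number of
    reduced closed paths of [Y] ([sum_closed_lifts]). *)

Set Implicit Arguments.
Unset Strict Implicit.
Unset Printing Implicit Defensive.

Import GRing.Theory.

Local Open Scope ring_scope.

(** * Logarithmic derivatives of power series *)

(** The derivation [u d/du]; unlike [d/du] it preserves degrees, which keeps the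
    coefficients of logarithmic derivatives indexed by the length of paths. *)
Definition fps_theta (K : fieldType) (f : fps K) : fps K :=
  Fps (fun n => f n *+ n).

(** [h] is the logarithmic derivative of [f] for [u d/du].  Normalising the
    constant term to [1] makes [h] determine [f] in characteristic [0]. *)
Definition has_logder (K : fieldType) (f h : fps K) : Prop :=
  f 0%N = 1 /\ fps_theta f = h * f.

Section LogDerivative.

Variable K : fieldType.
Implicit Types f g h : fps K.

Lemma coef_fpsD f g n : (f + g) n = f n + g n. Proof. by []. Qed.
Lemma coef_fpsN f n : (- f) n = - f n. Proof. by []. Qed.
Lemma coef_fps1 n : (1 : fps K) n = (n == 0%N)%:R.
Proof. by rewrite /=; case: n. Qed.

Lemma coef_fpsMn f k n : (f *+ k) n = f n *+ k.
Proof. by elim: k => // k IHk; rewrite !mulrS -IHk. Qed.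

Lemma coef_fpsM0 f g : (f * g) 0%N = f 0%N * g 0%N.
Proof. by rewrite coef_fpsM big_ord1. Qed.

Lemma coef_fpsXn l n : (fpsX K ^+ l) n = (n == l)%:R.
Proof.
elim: l n => [|l IHl] n; first by rewrite expr0 coef_fps1.
rewrite exprS coef_fpsM; case: n => [|n]; first by rewrite big_ord1 mul0r.
rewrite big_ord_recl big_ord_recl /= mul0r add0r mul1r subSS subn0 IHl.
by rewrite big1 ?addr0 // => i _; rewrite mul0r.
Qed.

Lemma coef_fpsXnM l f n :
  (fpsX K ^+ l * f) n = if (l <= n)%N then f (n - l)%N else 0.
Proof.
rewrite coef_fpsM; case: leqP => [le_ln | lt_nl].
  rewrite (bigD1 (inord l)) //= inordK ?ltnS // coef_fpsXn eqxx mul1r.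
  rewrite big1 ?addr0 // => i; rewrite coef_fpsXn -val_eqE /= inordK ?ltnS //.
  by move/negPf->; rewrite mul0r.
rewrite big1 // => i _; rewrite coef_fpsXn.
by rewrite (ltn_eqF (leq_ltn_trans (leq_ord i) lt_nl)) mul0r.
Qed.

Lemma fps_theta_is_zmod_morphism : zmod_morphism (@fps_theta K).
Proof. by move=> f g; apply: fpsP => n /=; rewrite mulrnBl. Qed.
HB.instance Definition _ :=
  GRing.isZmodMorphism.Build (fps K) (fps K) (@fps_theta K)
    fps_theta_is_zmod_morphism.

Lemma fps_thetaM f g : fps_theta (f * g) = fps_theta f * g + f * fps_theta g.
Proof.
apply: fpsP => n; rewrite coef_fpsD !coef_fpsM -big_split /=.
rewrite -sumrMnl; apply: eq_bigr => i _.
by rewrite mulrnAl mulrnAr -mulrnDr subnKC ?leq_ord.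
Qed.

Lemma fps_theta1 : fps_theta 1 = 0 :> fps K.
Proof. by apply: fpsP => -[|n] //=; rewrite mul0rn. Qed.

(** The Leibniz rule for a product; distinctness of the indices lets [j != i]
    single out the differentiated factor. *)
Lemma fps_theta_prod_uniq (I : eqType) (r : seq I) (F : I -> fps K) : uniq r ->
  fps_theta (\prod_(i <- r) F i)
    = \sum_(i <- r) fps_theta (F i) * \prod_(j <- r | j != i) F j.
Proof.
elim: r => [|i r IHr] /=; first by rewrite !big_nil fps_theta1.
case/andP=> i_r /IHr {}IHr; rewrite !big_cons eqxx fps_thetaM IHr /=.
congr (_ * _ + _).
  rewrite big_seq_cond [RHS]big_seq_cond; apply: eq_bigl => j.
  by case: eqP => [->|]; rewrite ?(negPf i_r) ?andbT.
rewrite mulr_sumr !big_seq; apply: eq_bigr => j r_j.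
rewrite mulrCA big_cons; case: eqP r_j => [<-|//].
by rewrite (negPf i_r).
Qed.

Lemma has_logder1 : has_logder (1 : fps K) 0.
Proof. by split=> //; rewrite fps_theta1 mul0r. Qed.

Lemma has_logderM f1 f2 h1 h2 :
  has_logder f1 h1 -> has_logder f2 h2 -> has_logder (f1 * f2) (h1 + h2).
Proof.
case=> c1 d1 [c2 d2]; split; first by rewrite coef_fpsM0 c1 c2 mul1r.
by rewrite fps_thetaM d1 d2 mulrDl -mulrA (mulrCA f1 h2).
Qed.

Lemma has_logderX f h k : has_logder f h -> has_logder (f ^+ k) (h *+ k).
Proof.
move=> fh; elim: k => [|k IHk]; first exact: has_logder1.
by rewrite exprS mulrS; apply: has_logderM.
Qed.

Lemma has_logder_prod (I : Type) (r : seq I) (P : pred I) (F H : I -> fps K) :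
  (forall i, P i -> has_logder (F i) (H i)) ->
  has_logder (\prod_(i <- r | P i) F i) (\sum_(i <- r | P i) H i).
Proof.
move=> FH; elim/big_rec2: _ => [|i h f Pi]; first exact: has_logder1.
exact/has_logderM/FH.
Qed.

Lemma has_logderV f h : has_logder f h -> has_logder f^-1 (- h).
Proof.
case=> c d; have uf : f \is a GRing.unit.
  by rewrite -[_ \is a _]/(f 0%N != 0) c oner_eq0.
have c' : f^-1 0%N = 1.
  by have := coef_fpsM0 f f^-1; rewrite divrr // c mul1r.
split=> //; apply: (mulIr uf); apply/eqP.
rewrite !mulNr -addr_eq0 -mulrA mulVr // mulr1.
rewrite -[X in _ + X](mulrK uf) -d [_ / f]mulrC; apply/eqP.
by rewrite -fps_thetaM mulVr // fps_theta1.
Qed.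

Lemma has_logder_coef0 f h : has_logder f h -> h 0%N = 0.
Proof.
case=> c d; have : fps_theta f 0%N = (h * f) 0%N by rewrite d.
by rewrite coef_fpsM0 c mulr1 => <-.
Qed.

Hypothesis charK : [pchar K] =i pred0.

(** The equation [u f' = h f] reads [n f_n = h_1 f_(n-1) + ... + h_n f_0], and
    [n] is invertible, so the coefficients of [h] up to degree [n] determine
    [f_n]. *)
Lemma has_logder_agree f1 f2 h1 h2 n : has_logder f1 h1 -> has_logder f2 h2 ->
  (forall m, (m <= n)%N -> h1 m = h2 m) -> f1 n = f2 n.
Proof.
move=> fh1 [c2 d2]; have h0 := has_logder_coef0 fh1; case: fh1 => c1 d1.
elim/ltn_ind: n => -[_ _|n IHn eq_h]; first by rewrite c1 c2.
have n0 : n.+1%:R != 0 :> K by rewrite (pcharf0P _).1.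
apply: (mulIf n0); rewrite !mulr_natr.
rewrite -[LHS]/(fps_theta f1 n.+1) -[RHS]/(fps_theta f2 n.+1) d1 d2.
rewrite !coef_fpsM big_ord_recl [RHS]big_ord_recl -(eq_h 0%N) // h0 !mul0r.
congr (_ + _); apply: eq_bigr => i _; rewrite lift0 subSS.
rewrite eq_h ?IHn // ?ltnS ?leq_subr // => m le_m; apply: eq_h.
by rewrite (leq_trans le_m) // ltnW // ltnS leq_subr.
Qed.

Lemma has_logder_inj f1 f2 h : has_logder f1 h -> has_logder f2 h -> f1 = f2.
Proof.
by move=> fh1 fh2; apply: fpsP => n; apply: has_logder_agree fh1 fh2 _.
Qed.

(** The order condition on [H l] makes the factor [P l] equal to [1 + O(u^l)],
    so that each coefficient is that of a finite product. *)
Lemma has_logder_fps_prod (P H : nat -> fps K) :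
    (forall l, has_logder (P l) (H l)) ->
    (forall l m, (m < l)%N -> H l m = 0) ->
  has_logder (fps_prod P) (Fps (fun m => \sum_(l < m.+1) H l m)).
Proof.
move=> PH H0; have P1 l m : (m < l)%N -> P l m = (1 : fps K) m.
  move=> lt_ml; apply: has_logder_agree (PH l) has_logder1 _ => k le_km.
  by rewrite H0 // (leq_ltn_trans le_km).
split; first by rewrite /= big_ord1; case: (PH 0%N).
apply: fpsP => n; have [_ dP] := has_logder_prod (index_enum 'I_n.+1)
  (fun i : 'I_n.+1 => fun _ : true => PH i).
(* Up to degree [n], only the factors of index at most [n] contribute. *)
transitivity ((fps_theta (\prod_(l < n.+1) P l)) n); first by [].
rewrite dP !coef_fpsM; apply: eq_bigr => i _.
rewrite (fps_prodE P1 (_ : (_ < n.+1)%N)) ?ltnS ?leq_subr //; congr (_ * _).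
rewrite coef_fps_sum [RHS](big_ord_widen n.+1 (fun l => H l i)) ?ltn_ord //.
rewrite [RHS]big_mkcond; apply: eq_bigr => l _.
by case: ltnP => // lt_il; rewrite H0.
Qed.

End LogDerivative.

Section LogDerivativeDet.

Variable K : fieldType.

Definition fps_const (f : fps K) : K := f 0%N.

Lemma fps_const_is_zmod_morphism : zmod_morphism fps_const.
Proof. by []. Qed.
Lemma fps_const_is_monoid_morphism : monoid_morphism fps_const.
Proof. by split=> // f g; apply: coef_fpsM0. Qed.
HB.instance Definition _ := GRing.isZmodMorphism.Build (fps K) K
  fps_const fps_const_is_zmod_morphism.
HB.instance Definition _ := GRing.isMonoidMorphism.Build (fps K) K
  fps_const fps_const_is_monoid_morphism.

(** Jacobi's formula. *)
Lemma fps_theta_det n (M : 'M[fps K]_n) :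
  fps_theta (\det M) = \tr (map_mx (@fps_theta K) M *m \adj M).
Proof.
rewrite raddf_sum /mxtrace.
under [RHS]eq_bigr => i _.
  rewrite mxE; under eq_bigr => j _ do rewrite !mxE expand_cofactor mulr_sumr.
  rewrite (exchange_big_dep predT) //=.
  over.
rewrite exchange_big /=; apply: eq_bigr => s _.
have -> : fps_theta ((-1) ^+ s * \prod_i M i (s i))
    = (-1) ^+ s * fps_theta (\prod_i M i (s i)).
  by rewrite -signr_odd; case: odd; rewrite ?mul1r // !mulN1r raddfN.
rewrite fps_theta_prod_uniq ?index_enum_uniq // mulr_sumr.
apply: eq_bigr => i _; rewrite [RHS](big_pred1 (s i)); last first.
  by move=> j; rewrite /= eq_sym.
rewrite mulrCA; congr (_ * (_ * _)).
by apply: eq_bigl => j; rewrite eq_sym.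
Qed.

(** With [M = 1 - A u^l], the inverse of [M] is the geometric series
    [S = sum_k A^k u^(l k)] and the derivation sends [M] to [l (M - 1)].
    Jacobi's formula therefore gives [l * tr ((M - 1) S) = l * tr (1 - S)]. *)
Lemma has_logder_det (n l : nat) (A : 'M[K]_n) : (0 < l)%N ->
  has_logder (\det (1%:M - fpsX K ^+ l *: map_mx (@fpsC K) A))
    (Fps (fun m => if (0 < m)%N && (l %| m)%N
                   then - (\tr (A ^+ (m %/ l)%N) *+ l) else 0)).
Proof.
move=> l_gt0; set M := 1%:M - _.
pose S : 'M[fps K]_n := \matrix_(i, j)
  Fps (fun m => if (l %| m)%N then (A ^+ (m %/ l)%N) i j else 0).
have ME i j : M i j = (i == j)%:R - fpsX K ^+ l * fpsC (A i j) by rewrite !mxE.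
have MS : M *m S = 1%:M.
  apply/matrixP=> i j; rewrite mxE.
  have -> : \sum_k M i k * S k j
      = S i j - fpsX K ^+ l * \sum_k fpsC (A i k) * S k j.
    rewrite mulr_sumr -sumrN -[S i j]mul1r.
    under eq_bigr => k _ do rewrite ME mulrBl -mulrA.
    rewrite big_split /= (bigD1 i) //= eqxx big1 ?addr0 // => k.
    by rewrite eq_sym => /negPf ->; rewrite mul0r.
  have CM c (f : fps K) m : (fpsC c * f) m = c * f m.
    rewrite coef_fpsM big_ord_recl subn0 big1 ?addr0 // => k _.
    by rewrite /= mul0r.
  apply: fpsP => m; rewrite coef_fpsD coef_fpsN coef_fpsXnM mxE /=.
  rewrite mxE coef_fpsMn coef_fps1; case: leqP => [le_lm|lt_ml]; last first.
    rewrite subr0; case: m lt_ml => [|m] lt_ml /=.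
      by rewrite dvdn0 div0n expr0 mxE.
    by rewrite (gtnNdvd _ lt_ml) //= mul0rn.
  rewrite coef_fps_sum; under eq_bigr => k _ do rewrite CM mxE /=.
  rewrite -[X in (l %| X)%N](subnK le_lm) dvdn_addl //.
  rewrite (negPf (_ : m != 0)%N) ?mul0rn -?lt0n ?(leq_trans l_gt0) //.
  case: ifP => [dv|_]; last by rewrite big1 ?subr0 // => k _; rewrite mulr0.
  rewrite -[X in (X %/ l)%N](subnK le_lm) divnDr // divnn l_gt0 addn1 exprS.
  by rewrite -[_ * _]/(_ *m _) mxE subrr.
split.
  rewrite -[LHS]/(fps_const _) -det_map_mx.
  have -> : map_mx fps_const M = 1%:M; last by rewrite det1.
  apply/matrixP=> i j; rewrite [LHS]mxE ME mxE /fps_const.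
  rewrite coef_fpsD coef_fpsN coef_fpsM0 coef_fpsXn ltn_eqF // mul0r subr0.
  by rewrite coef_fpsMn coef_fps1.
have adjM : \adj M = \det M *: S.
  by rewrite -[LHS]mulmx1 -MS mulmxA mul_adj_mx mul_scalar_mx.
rewrite fps_theta_det adjM -scalemxAr linearZ /= mulrC; congr (_ * _).
have -> : map_mx (@fps_theta K) M = (M - 1%:M) *+ l.
  apply/matrixP=> i j; rewrite mulmxnE [LHS]mxE [X in X *+ l]mxE ME.
  rewrite [(- 1%:M) i j]mxE.
  rewrite [1%:M i j]mxE.
  rewrite addrAC subrr add0r raddfB raddfMn /= fps_theta1 mul0rn sub0r.
  apply: fpsP => m; rewrite coef_fpsMn !coef_fpsN mulNrn; congr (- _).
  rewrite -[LHS]/((fpsX K ^+ l * fpsC (A i j)) m *+ m) coef_fpsXnM.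
  case: leqP => [le_lm|_].
    have [->//|ne_ml] := eqVneq m l.
    by rewrite /= subn_eq0 leqNgt ltn_neqAle eq_sym ne_ml le_lm !mul0rn.
  by rewrite !mul0rn.
rewrite -scaler_nat -scalemxAl mulmxBl MS mul1mx scaler_nat.
apply: fpsP => m; rewrite raddfMn raddfB /= mxtrace1.
rewrite coef_fpsMn coef_fpsD coef_fpsN coef_fpsMn coef_fps1 coef_fps_sum.
under eq_bigr => i _ do rewrite mxE /=.
have [->|m_gt0] := posnP; first rewrite dvdn0 div0n expr0.
  by rewrite -[\sum_i _]/(\tr 1%:M) mxtrace1 subrr mul0rn.
rewrite mul0rn sub0r mulNrn /=; case: (l %| m)%N; first by [].
by rewrite big1 // mul0rn oppr0.
Qed.

Lemma has_logder_det_inv (n l : nat) (A : 'M[K]_n) : (0 < l)%N ->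
  has_logder (\det (1%:M - fpsX K ^+ l *: map_mx (@fpsC K) A))^-1
    (Fps (fun m => if (0 < m)%N && (l %| m)%N
                   then \tr (A ^+ (m %/ l)%N) *+ l else 0)).
Proof.
move=> l_gt0; have := has_logderV (has_logder_det A l_gt0).
set h := Fps _; set h' := Fps _; suff -> : - h = h' by [].
by apply: fpsP => m /=; case: ifP; rewrite ?opprK ?oppr0.
Qed.
End LogDerivativeDet.

(** * Periods and primitive roots of words *)

Definition word_pow (T : Type) (k : nat) (t : seq T) : seq T :=
  flatten (nseq k t).

Section Words.

Variable T : eqType.
Implicit Types s t : seq T.

(* Rotation by more than the length is trivial; this bound also serves the empty
   word. *)
Fact ex_period s : exists d, (0 < d)%N && (rot d s == s).
Proof. by exists (size s).+1; rewrite rot_oversize //= eqxx. Qed.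

Definition period s : nat := ex_minn (ex_period s).

(** Stated by rotations, which makes invariance under cyclic shifts immediate;
    [primitiveP] is the usual formulation by powers. *)
Definition primitive s : bool := (s != [::]) && (period s == size s).

Lemma period_gt0 s : (0 < period s)%N.
Proof. by rewrite /period; case: ex_minnP => d /andP[]. Qed.

Lemma rot_period s : rot (period s) s = s.
Proof. by rewrite /period; case: ex_minnP => d /andP[_ /eqP]. Qed.

Lemma period_min s d : (0 < d)%N -> rot d s = s -> (period s <= d)%N.
Proof.
rewrite /period; case: ex_minnP => p _ minp d_gt0 rot_d; apply: minp.
by rewrite d_gt0 rot_d eqxx.
Qed.

Lemma period_leq s : s != [::] -> (period s <= size s)%N.
Proof. by rewrite -size_eq0 -lt0n => s0; apply: period_min; rewrite ?rot_size. Qed.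

(** Periods are closed under subtraction, so subtracting the least period from
    [d] as often as possible leaves a smaller period, which must vanish. *)
Lemma period_dvd s d :
  (0 < d)%N -> (d <= size s)%N -> rot d s = s -> (period s %| d)%N.
Proof.
move=> d_gt0 le_d rot_d; set p := period s.
have rot_sub j : (j * p <= d)%N -> rot (d - j * p) s = s.
  elim: j => [|j IHj]; first by rewrite subn0.
  rewrite mulSn => le_jp; rewrite -[RHS]IHj; last first.
    by rewrite (leq_trans _ le_jp) ?leq_addl.
  have -> : (d - j * p = d - (p + j * p) + p)%N.
    rewrite subnDA subnAC subnK // leq_subRL ?(leq_trans _ le_jp) ?leq_addl //.
    by rewrite addnC.
  rewrite rotD ?rot_period // -subnA ?leq_addr ?addKn //.
  by rewrite (leq_trans (leq_subr _ _)).
rewrite /dvdn; case: posnP => // md_gt0.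
have := rot_sub (d %/ p)%N (leq_trunc_div d p).
rewrite {1}(divn_eq d p) addKn => /(period_min md_gt0).
by rewrite leqNgt ltn_mod period_gt0.
Qed.

Lemma size_word_pow k t : size (word_pow k t) = (k * size t)%N.
Proof. by elim: k => //= k IHk; rewrite size_cat IHk mulSn. Qed.

Lemma word_powD j k t : word_pow (j + k) t = word_pow j t ++ word_pow k t.
Proof. by rewrite /word_pow nseqD flatten_cat. Qed.

Lemma word_powSr k t : word_pow k.+1 t = word_pow k t ++ t.
Proof. by rewrite -addn1 word_powD /word_pow /= cats0. Qed.

Lemma word_powM j k t : word_pow (j * k) t = word_pow j (word_pow k t).
Proof. by elim: j => //= j IHj; rewrite mulSn word_powD IHj. Qed.

Lemma rot_word_pow k t : rot (size t) (word_pow k t) = word_pow k t.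
Proof. by case: k => // k; rewrite /= rot_size_cat -word_powSr. Qed.

(** Commuting words are powers of a common word, which is [t] when the length of
    [r] is a multiple of that of [t]. *)
Lemma commuting_word_pow k t r :
  t ++ r = r ++ t -> size r = (k * size t)%N -> r = word_pow k t.
Proof.
elim: k r => [|k IHk] r tr sz; first exact: size0nil.
have rE : r = t ++ drop (size t) r.
  rewrite -{1}(cat_take_drop (size t) r); congr (_ ++ _).
  have := congr1 (take (size t)) tr; rewrite take_size_cat //.
  by rewrite takel_cat ?sz ?mulSn ?leq_addr // => /esym.
rewrite /= {1}rE; congr (_ ++ _); apply: IHk.
  by move: tr; rewrite {1 2}rE -catA => /eqP; rewrite eqseq_cat // eqxx => /eqP.
by rewrite size_drop sz mulSn addKn.
Qed.

(** Invariance under rotation by [d] says that the first [d] letters commute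
    with the rest. *)
Lemma word_powK s d : (0 < d)%N -> (d %| size s)%N -> rot d s = s ->
  word_pow (size s %/ d) (take d s) = s.
Proof.
move=> d_gt0 dv rot_d; have [->|s0] := eqVneq s [::].
  by rewrite /= div0n.
have sz_gt0 : (0 < size s)%N by rewrite lt0n size_eq0.
have le_d := dvdn_leq sz_gt0 dv; have szt := size_takel le_d.
rewrite -[RHS](cat_take_drop d) -[(_ %/ d)%N]prednK ?divn_gt0 //.
rewrite -[LHS]/(_ ++ word_pow _ _); congr (_ ++ _); apply/esym/commuting_word_pow.
  by rewrite cat_take_drop -[LHS]rot_d.
by rewrite size_drop szt -subn1 mulnBl mul1n divnK.
Qed.

Lemma take_word_pow k t : (0 < k)%N -> take (size t) (word_pow k t) = t.
Proof. by case: k => // k _; rewrite /= take_size_cat. Qed.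

(** The least period of [t^k] divides the length of [t], hence is already a
    period of its prefix [t]. *)
Lemma period_word_pow k t : (0 < k)%N -> t != [::] ->
  period (word_pow k t) = period t.
Proof.
move=> k_gt0 t0; set s := word_pow k t; set p := period s.
have t_gt0 : (0 < size t)%N by rewrite lt0n size_eq0.
have sz := size_word_pow k t; have le_ts : (size t <= size s)%N.
  by rewrite sz leq_pmull.
have p_dvd : (p %| size t)%N by apply: period_dvd (rot_word_pow k t).
have p_dvds : (p %| size s)%N by rewrite sz dvdn_mull.
have le_pt := dvdn_leq t_gt0 p_dvd.
have s_pow := word_powK (period_gt0 s) p_dvds (rot_period s).
have szp : size (take p s) = p by rewrite size_takel // (leq_trans le_pt).
have t_pow : t = word_pow (size t %/ p) (take p s).
  rewrite -[LHS](take_word_pow t k_gt0) -/s -{1}s_pow -/p.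
  rewrite sz -muln_divA // -[k in LHS]prednK // mulSn word_powD.
  by rewrite take_cat size_word_pow szp divnK // ltnn subnn take0 cats0.
apply/eqP; rewrite eqn_leq; apply/andP; split; last first.
  by apply: period_min; rewrite ?period_gt0 // t_pow -[X in rot X]szp rot_word_pow.
apply: period_min; first exact: period_gt0.
have q_dvd : (period t %| size t)%N by apply: period_dvd; rewrite ?rot_size.
have q_le := dvdn_leq t_gt0 q_dvd.
rewrite /s; move: q_dvd q_le (period_gt0 t) (rot_period t).
move: (period t) => q q_dvd q_le q_gt0 rot_q.
have -> : word_pow k t = word_pow (k * (size t %/ q)) (take q t).
  by rewrite word_powM word_powK.
by rewrite -[X in rot X](size_takel q_le) rot_word_pow.
Qed.

Lemma primitive_rot k s : primitive (rot k s) = primitive s.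
Proof.
rewrite /primitive -!size_eq0 size_rot; congr (_ && (_ == _)).
have rotE d : (rot d (rot k s) == rot k s) = (rot d s == s).
  by rewrite rot_rot (inj_eq (@rot_inj _ _)).
apply/eqP; rewrite eqn_leq; apply/andP; split; apply: period_min;
  rewrite ?period_gt0 //; apply/eqP.
  by rewrite rotE rot_period.
by rewrite -rotE rot_period.
Qed.

Lemma primitive_rot_inj s i j : primitive s ->
  (i < size s)%N -> (j < size s)%N -> rot i s = rot j s -> i = j.
Proof.
case/andP=> _ /eqP per; wlog le_ij : i j / (i <= j)%N.
  move=> W lti ltj eq_rot; case/orP: (leq_total i j) => le; first exact: W.
  exact/esym/W.
move=> lti ltj; rewrite -{1}(subnKC le_ij) rotD ?subnKC ?(ltnW ltj) //.
move/rot_inj/esym; case: (posnP (j - i)%N) => [/eqP|ij_gt0].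
  by rewrite subn_eq0 => le_ji _; apply/eqP; rewrite eqn_leq le_ij.
move/(period_min ij_gt0); rewrite per leqNgt.
by rewrite (leq_ltn_trans (leq_subr _ _) ltj).
Qed.

Lemma primitiveP s :
  reflect (s != [::] /\ forall k t, s = word_pow k t -> k = 1%N) (primitive s).
Proof.
apply: (iffP andP) => -[s0 per]; split=> //.
  move=> k t st; have [k0|k_gt0] := posnP k; first by rewrite st k0 in s0.
  have t0 : t != [::].
    by apply: contraNneq s0 => t0; rewrite -size_eq0 st size_word_pow t0 muln0.
  have t_gt0 : (0 < size t)%N by rewrite lt0n size_eq0.
  move: per; rewrite st period_word_pow // size_word_pow => /eqP per.
  have := period_leq t0; rewrite per -{2}[size t]mul1n leq_pmul2r // => le_k1.
  by apply/eqP; rewrite eqn_leq le_k1.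
have s_gt0 : (0 < size s)%N by rewrite lt0n size_eq0.
have p_dvd : (period s %| size s)%N by apply: period_dvd; rewrite ?rot_size.
have := per _ _ (esym (word_powK (period_gt0 s) p_dvd (rot_period s))).
by move=> q1; rewrite -[X in _ == X](divnK p_dvd) q1 mul1n.
Qed.

End Words.

(** Words are grouped by their least period [l]; taking the first [l] letters
    and raising to the power [m / l] are inverse bijections between the words of
    length [m] and period [l] and the primitive words of length [l]. *)
Lemma sum_words_by_root (V : nmodType) (T : finType) (m : nat)
    (P : pred (seq T)) (w : seq T -> V) :
    (0 < m)%N ->
    (forall k t, (0 < k)%N -> t != [::] -> P (word_pow k t) = P t) ->
  \sum_(s : m.-tuple T | P s) w s =
  \sum_(l < m.+1 | (0 < l)%N && (l %| m)%N)
     \sum_(t : l.-tuple T | P t && primitive t) w (word_pow (m %/ l) t).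
Proof.
move=> m_gt0 Ppow.
have nonnil n (s : n.-tuple T) : (0 < n)%N -> tval s != [::].
  by rewrite -size_eq0 size_tuple -lt0n.
have per_dvd (s : m.-tuple T) : (period s %| m)%N.
  by rewrite -{2}(size_tuple s) period_dvd ?rot_size // size_tuple.
have per_lt (s : m.-tuple T) : (period s < m.+1)%N.
  by rewrite ltnS dvdn_leq.
rewrite (partition_big (fun s : m.-tuple T => Ordinal (per_lt s))
  (fun l : 'I_m.+1 => (0 < l)%N && (l %| m)%N)) /= => [|s _]; last first.
  by rewrite period_gt0 per_dvd.
apply: eq_bigr => l /andP[l_gt0 l_dvd].
have ml_gt0 : (0 < m %/ l)%N by rewrite divn_gt0 // dvdn_leq.
have sz_pow (t : l.-tuple T) : size (word_pow (m %/ l) t) == m.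
  by rewrite size_word_pow size_tuple divnK.
have le_lm : (l <= m)%N by rewrite -ltnS.
have sz_take (s : m.-tuple T) : size (take l s) == l.
  by rewrite size_takel // size_tuple.
rewrite (reindex_onto (fun t : l.-tuple T => Tuple (sz_pow t))
                      (fun s : m.-tuple T => Tuple (sz_take s))) /=.
  apply: eq_big => // t; rewrite -val_eqE /= Ppow ?nonnil //.
  rewrite period_word_pow ?nonnil // /primitive nonnil // size_tuple /=.
  rewrite (_ : Tuple _ == t) ?andbT // -val_eqE /=.
  by rewrite -[X in take X](size_tuple t) take_word_pow.
move=> s /andP[_ /eqP/(congr1 val)/= per_s]; apply: val_inj => /=.
rewrite -[X in (X %/ _)%N](size_tuple s) word_powK ?size_tuple //.
by rewrite -per_s rot_period.
Qed.

(** * Prime cycles as primitive cyclic words *)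

(** This is the identity [(b a)^j b = b (a b)^j]. *)
Lemma word_pow_rot (T : eqType) (j k : nat) (t : seq T) : (k <= size t)%N ->
  word_pow j (rot k t) = rot k (word_pow j t).
Proof.
move=> le_k; have shift a b i : word_pow i (b ++ a) ++ b = b ++ word_pow i (a ++ b).
  elim: i => [|i IHi]; first by rewrite cats0.
  rewrite -[word_pow i.+1 (b ++ a)]/((b ++ a) ++ _) -catA IHi -!catA.
  by rewrite -[word_pow i.+1 (a ++ b)]/((a ++ b) ++ _) -!catA.
rewrite [in LHS]/rot -{3}(cat_take_drop k t) -{3}(size_takel le_k).
move: (take k t) (drop k t) => a b; case: j => [|j]; first by case: (size a).
rewrite -[word_pow j.+1 (a ++ b)]/((a ++ b) ++ _) -catA rot_size_cat -shift.
by rewrite -catA -word_powSr.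
Qed.

Section PrimeCycles.

Variable H : hypergraph.

(** A letter [(e, v)] stands for an edge and the vertex reached through it.  The
    relation holds all conditions on consecutive letters of a prime cycle, so
    that the absence of a tail becomes the condition between the last letter and
    the first one. *)
Definition step : rel (edge H * vert H) := fun x y =>
  [&& x.2 \in eset y.1, y.2 \in eset y.1, x.2 != y.2 & x.1 != y.1].

Lemma is_path_from_cat v (s1 s2 : seq (edge H * vert H)) :
  is_path_from v (s1 ++ s2)
    = is_path_from v s1 && is_path_from (last v (unzip2 s1)) s2.
Proof. by elim: s1 v => //= -[e w] s1 IHs v; rewrite IHs !andbA. Qed.

Lemma path_stepE f v s : path step (f, v) s =
  [&& is_path_from v s, path (fun v w => v != w) v (unzip2 s)
    & path (fun e f => e != f) f (unzip1 s)].
Proof.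
elim: s f v => //= -[e w] s IHs f v; rewrite IHs /step /=.
by case: (v \in _); case: (w \in _); case: (v != w); case: (f != e);
   rewrite //= ?andbF.
Qed.

Lemma cycle_step_size s : path.cycle step s -> s != [::] -> (1 < size s)%N.
Proof.
case: s => [|x [|y s]] //=; rewrite andbT /step => /and4P[_ _].
by rewrite eqxx.
Qed.

(** The edge sequence of the doubled word contains the pair formed by the last
    edge and the first one, which is the only comparison missing from a single
    copy. *)
Lemma cycle_stepE v s : s != [::] -> v = last v (unzip2 s) ->
  path.cycle step s = [&& is_path_from v s, path (fun v w => v != w) v (unzip2 s),
     sorted (fun e f => e != f) (unzip1 s) &
     sorted (fun e f => e != f) (unzip1 (s ++ s))].
Proof.
case: s => [//|[e w] s] _ vE; rewrite (cycle_path (e, v)).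
have -> : last (e, v) ((e, w) :: s) = (last e (unzip1 s), v).
  by rewrite {2}vE /= {vE}; elim: s e w => //= -[f x] s IHs e w; exact: IHs.
rewrite path_stepE; congr [&& _, _ & _].
rewrite [unzip1 (_ ++ _)]map_cat /= cat_path /=.
by rewrite andbCA; case: path; rewrite ?andbF ?andbT //=.
Qed.

(** Powers of arbitrary words may be tested instead of powers of cycles: a root
    of a reduced closed walk closes up at the same vertex, and it has length at
    least [2] because no letter may follow itself. *)
Lemma prime_cycleP (C : walk H) :
  prime_cycle C <-> [/\ path.cycle step C.2, primitive C.2 & C.1 = target C].
Proof.
case: C => v s; rewrite /target /=; split=> [[/and3P[/= Cpath sz_s /eqP Cv]]|].
  rewrite /source /target /= in Cv.
  rewrite /edge_backtracking /has_tail /edge_backtracking !negbK /= cats0.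
  move=> Cvert Cedge Ctail Cprim.
  have s0 : s != [::] by rewrite -size_eq0 -lt0n ltnW.
  have Cstep : path.cycle step s by rewrite (cycle_stepE s0 Cv); apply/and4P.
  split=> //; apply/primitiveP; split=> // k t st.
  have [k0|k_gt0] := posnP k; first by rewrite st k0 in s0.
  case: (ltnP 1 k) => [k_gt1|]; last first.
    by move=> le_k1; apply/eqP; rewrite eqn_leq le_k1.
  have t0 : t != [::].
    by apply: contraNneq s0 => t0; rewrite -size_eq0 st size_word_pow t0 muln0.
  case: (Cprim (v, t) k _ k_gt1); last by rewrite /cycle_pow /= st.
  have s_last : last v (unzip2 s) = last v (unzip2 t).
    rewrite st -(prednK k_gt0) word_powSr /unzip2 map_cat last_cat.
    by case: (t) t0.
  have s_first : s = t ++ word_pow k.-1 t by rewrite st -{1}(prednK k_gt0).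
  apply/and3P; split=> /=; last by rewrite /source /target /= -s_last -Cv.
    by move: Cpath; rewrite s_first /is_path /= is_path_from_cat => /andP[].
  case: (t) t0 st => [|x [|y r]] //= _ st.
  move: Cstep; rewrite st -(prednK k_gt0) -(prednK (_ : 0 < k.-1)%N); last first.
    by rewrite -subn1 subn_gt0.
  by rewrite /= /step eqxx !andbF.
case=> Cstep Cprim Cv; have [s0 prim_s] := primitiveP _ Cprim.
have := Cstep; rewrite (cycle_stepE s0 Cv) => /and4P[C1 C2 C3 C4].
split=> //.
- by apply/and3P; split; rewrite /source /target //= -?Cv // cycle_step_size.
- by rewrite /edge_backtracking negbK.
- by rewrite /has_tail /edge_backtracking negbK /= cats0.
move=> [w t] k _ k_gt1 [_ st].
by rewrite (prim_s k t st) in k_gt1.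
Qed.

Lemma mem_prime_cycles l (C : lwalk H l) : (C \in prime_cycles H l) =
  [&& path.cycle step C.2, primitive C.2 & C.1 == target (walk_of C)].
Proof.
rewrite inE; apply/asboolP/and3P => [/prime_cycleP|] [? ? Cv].
  by split=> //; apply/eqP.
by apply/prime_cycleP; split=> //; apply/eqP.
Qed.

Lemma last_default (T : Type) (x y : T) s : s <> [::] -> last x s = last y s.
Proof. by case: s. Qed.

Lemma prime_cycle_inj l :
  {in prime_cycles H l &, injective (fun C : lwalk H l => C.2)}.
Proof.
move=> [v s] [w t]; rewrite !mem_prime_cycles /target /=.
case/and3P=> _ prim_s /eqP vE /and3P[_ _ /eqP wE] eq_st.
case/andP: prim_s => s0 _; congr pair => //.
rewrite vE wE eq_st; apply: last_default => /(congr1 size)/eqP.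
rewrite size_map size_eq0 -eq_st => s_nil.
by rewrite s_nil in s0.
Qed.

(** The source of a cycle is its last vertex, so the word determines the
    cycle. *)
Lemma sum_prime_cycles (V : nmodType) l (w : seq (edge H * vert H) -> V) :
  \sum_(C in prime_cycles H l) w C.2 =
  \sum_(t : l.-tuple (edge H * vert H) | path.cycle step t && primitive t) w t.
Proof.
rewrite -(big_imset (fun t : l.-tuple _ => w t) (@prime_cycle_inj l)) /=.
apply: eq_bigl => t; apply/imsetP/andP => [[C]|[t_cyc t_prim]].
  by rewrite mem_prime_cycles => /and3P[? ? _] ->.
have [v _] := card_gt0P (vert_nonempty H).
exists (last v (unzip2 t), t) => //.
rewrite mem_prime_cycles t_cyc t_prim /target /=; apply/eqP.
apply: last_default => /(congr1 size)/eqP; rewrite size_map size_eq0.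
by case/andP: t_prim => /negPf->.
Qed.

Definition rot_lwalk l (C : lwalk H l) (k : nat) : lwalk H l :=
  (last C.1 (unzip2 (take k C.2)), [tuple of rot k C.2]).

Lemma rot_lwalk_prime l (C : lwalk H l) k :
  C \in prime_cycles H l -> rot_lwalk C k \in prime_cycles H l.
Proof.
rewrite !mem_prime_cycles /= rot_cycle primitive_rot /target /=.
case/and3P=> -> -> /= /eqP Cv; rewrite /rot /unzip2 map_cat !last_cat.
suff -> : last (last C.1 [seq i.2 | i <- take k C.2]) [seq i.2 | i <- drop k C.2]
    = C.1 by [].
by rewrite -last_cat -map_cat cat_take_drop.
Qed.

Lemma equiv_cycleE l (C D : lwalk H l) :
  equiv_cycle (walk_of C) (walk_of D) <->
  exists2 k, (k <= l)%N & D = rot_lwalk C k.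
Proof.
rewrite /equiv_cycle /= size_tuple; split=> -[k le_k E]; exists k => //.
  case: D E => w t [-> tE]; congr pair.
  exact: val_inj.
by rewrite E.
Qed.

Lemma equiv_prime_cycleP l (C D : lwalk H l) :
    C \in prime_cycles H l -> D \in prime_cycles H l ->
  reflect (exists2 k, (k <= l)%N & D.2 = rot k C.2 :> seq _)
    `[< equiv_cycle (walk_of C) (walk_of D) >].
Proof.
move=> primC primD; apply: (iffP (asboolP _)) => [/equiv_cycleE|] [k le_k DE].
  by exists k; rewrite ?DE.
apply/equiv_cycleE; exists k => //.
by apply: prime_cycle_inj; rewrite ?rot_lwalk_prime //; apply: val_inj.
Qed.

Lemma equiv_cycle_equivalence l : {in prime_cycles H l & &, equivalence_rel
  (fun C D => `[< equiv_cycle (walk_of C) (walk_of D) >])}.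
Proof.
move=> C D E primC primD primE.
have refl (B : lwalk H l) : B \in prime_cycles H l ->
    `[< equiv_cycle (walk_of B) (walk_of B) >].
  by move=> primB; apply/equiv_prime_cycleP=> //; exists 0%N; rewrite ?rot0.
have sym (A B : lwalk H l) : A \in prime_cycles H l -> B \in prime_cycles H l ->
    `[< equiv_cycle (walk_of A) (walk_of B) >] ->
    `[< equiv_cycle (walk_of B) (walk_of A) >].
  move=> primA primB /equiv_prime_cycleP[]// k le_k AB.
  apply/equiv_prime_cycleP=> //; exists (l - k)%N; rewrite ?leq_subr //.
  by rewrite AB -[LHS](rotK k) /rotr size_rot size_tuple.
have trans (A B F : lwalk H l) : A \in prime_cycles H l ->
    B \in prime_cycles H l -> F \in prime_cycles H l ->
    `[< equiv_cycle (walk_of A) (walk_of B) >] ->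
    `[< equiv_cycle (walk_of B) (walk_of F) >] ->
    `[< equiv_cycle (walk_of A) (walk_of F) >].
  move=> primA primB primF /equiv_prime_cycleP[]// j le_j AB.
  move=> /equiv_prime_cycleP[]// k le_k BF.
  apply/equiv_prime_cycleP=> //; exists (rot_add A.2 j k).
    by rewrite -[X in (_ <= X)%N](size_tuple A.2) leq_rot_add.
  by rewrite BF AB rot_rot_add.
split; first exact: refl.
move=> CD; apply/idP/idP; last exact: trans.
by apply: trans => //; apply: sym.
Qed.

Lemma prime_classes_partition l :
  partition (prime_classes H l) (prime_cycles H l).
Proof. exact/equivalence_partitionP/equiv_cycle_equivalence. Qed.

(** The rotations of a primitive word of length [l] by [0, ..., l - 1] are
    distinct. *)
Lemma card_prime_class l (c : {set lwalk H l}) :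
  c \in prime_classes H l -> #|c| = l.
Proof.
case/imsetP=> C primC ->; have := primC; rewrite mem_prime_cycles.
case/and3P=> _ C_prim _.
have -> : [set D in prime_cycles H l | `[< equiv_cycle (walk_of C) (walk_of D) >]]
    = [set rot_lwalk C (k : 'I_l) | k : 'I_l].
  apply/setP=> D; rewrite inE; apply/andP/imsetP => [[primD]|[k _ ->]].
    case/asboolP/equiv_cycleE=> k le_k ->; move: le_k; rewrite leq_eqVlt.
    case/predU1P=> [->|lt_k]; last by exists (Ordinal lt_k).
    have l_gt0 : (0 < l)%N.
      by rewrite -(size_tuple C.2) lt0n size_eq0; case/andP: C_prim.
    exists (Ordinal l_gt0) => //; apply: prime_cycle_inj;
      rewrite ?rot_lwalk_prime //; apply: val_inj => /=.
    by rewrite rot0 -[X in rot X](size_tuple C.2) rot_size.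
  split; first exact: rot_lwalk_prime.
  by apply/asboolP/equiv_cycleE; exists k; rewrite 1?ltnW.
rewrite card_in_imset ?card_ord // => i j _ _.
move/(congr1 (fun D : lwalk H l => val D.2)) => /= eq_rot.
by apply: val_inj; apply: primitive_rot_inj eq_rot; rewrite ?size_tuple.
Qed.

Lemma sum_prime_transversal (V : nmodType) l (phi : lwalk H l -> V) :
    (forall C k, (k <= l)%N -> phi (rot_lwalk C k) = phi C) ->
  \sum_(C in transversal (prime_classes H l) (prime_cycles H l)) phi C *+ l
    = \sum_(C in prime_cycles H l) phi C.
Proof.
move=> phi_rot; have partP := prime_classes_partition l.
have trP := transversalP partP.
rewrite (set_partition_big _ partP) /= -{2}(pblock_transversal trP).
rewrite [RHS]big_imset /=; last exact: pblock_inj trP.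
apply: eq_bigr => C CX; have CP : C \in prime_cycles H l.
  exact: subsetP (transversal_sub trP) C CX.
have C_in : C \in cover (prime_classes H l) by rewrite (cover_partition partP).
have Pc := pblock_mem C_in.
rewrite -{1}(card_prime_class Pc) -sumr_const; apply: eq_bigr => D D_in.
move: Pc D_in C_in; rewrite -mem_pblock; case/imsetP=> B primB ->.
rewrite !inE => /andP[primD /asboolP/equiv_cycleE[k le_k ->]].
case/andP=> _ /asboolP/equiv_cycleE[j le_j ->].
by rewrite !phi_rot.
Qed.

Lemma card_prime_transversal l :
  #|transversal (prime_classes H l) (prime_cycles H l)| = #|prime_classes H l|.
Proof. exact: card_transversal (transversalP (prime_classes_partition l)). Qed.

Lemma cycle_step_word_pow k (t : seq (edge H * vert H)) : (0 < k)%N ->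
  path.cycle step (word_pow k t) = path.cycle step t.
Proof.
case: t => [|x t] k_gt0.
  suff -> : word_pow k [::] = [::] :> seq (edge H * vert H) by [].
  by elim: k {k_gt0}.
rewrite !(cycle_path x).
elim: k k_gt0 => // -[|k] IHk _; first by rewrite /word_pow /= cats0.
rewrite word_powSr last_cat cat_path.
have lastE y : last y (word_pow k.+1 (x :: t)) = last x t.
  by rewrite word_powSr last_cat.
move: (IHk isT); rewrite !lastE => IHW.
by rewrite -[last _ (x :: t)]/(last x t) IHW andbb.
Qed.

(** Prime cycles are the primitive reduced words, and a class of length [l] is
    counted [l] times among them. *)
Lemma sum_cyclic_words (V : nmodType) m (w : seq (edge H * vert H) -> V) :
    (0 < m)%N -> (forall k s, w (rot k s) = w s) ->
  \sum_(s : m.-tuple (edge H * vert H) | path.cycle step s) w s =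
  \sum_(l < m.+1 | (0 < l)%N && (l %| m)%N)
    \sum_(C in transversal (prime_classes H l) (prime_cycles H l))
       w (word_pow (m %/ l)%N C.2) *+ l.
Proof.
move=> m_gt0 w_rot; rewrite (sum_words_by_root (P := path.cycle step)) //.
  apply: eq_bigr => l _.
  rewrite -(sum_prime_cycles l (fun t => w (word_pow (m %/ l)%N t))).
  rewrite -(sum_prime_transversal
    (phi := fun C : lwalk H l => w (word_pow (m %/ l)%N C.2))) // => C k le_k.
  by rewrite /= word_pow_rot ?size_tuple // w_rot.
by move=> k t k_gt0 _; apply: cycle_step_word_pow.
Qed.

End PrimeCycles.

(** * Tree paths and path lifting *)

(** At the first vertex [x] where two simple paths with the same endpoint part,
    into [b] and [c], following one to the end and the other back joins [b] to
    [c] without meeting [x]; closing this up through [x] gives a cycle with at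
    least three vertices. *)
Lemma acyclic_uniq_path (V : finType) (T : rel V) : symmetric T ->
    (forall c, ucycle T c -> (size c <= 2)%N) ->
  forall x p q, path T x p -> path T x q -> uniq (x :: p) -> uniq (x :: q) ->
    last x p = last x q -> p = q.
Proof.
move=> symT acycT x p; elim: p x => [|b p IHp] x [|c q] //=.
- move=> _ _ _ /andP[/negP x_q _] x_last; case: x_q.
  by rewrite {1}x_last mem_last.
- move=> _ _ /andP[/negP x_p _] _ x_last; case: x_p.
  by rewrite -{1}x_last mem_last.
move=> /andP[Txb Pp] /andP[Txc Pq] /andP[x_p Up] /andP[x_q Uq] eq_last.
have [bc|ne_bc] := eqVneq b c.
  by rewrite -bc in Pq Uq eq_last *; rewrite (IHp b q).
pose T' : rel V := fun y z => [&& T y z, y != x & z != x].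
have symT' : symmetric T'.
  by move=> y z; rewrite /T' symT; congr (_ && _); exact: andbC.
have avoid y r : path T y r -> x \notin y :: r -> path T' y r.
  elim: r y => //= z r IHr y /andP[Tyz Pr].
  rewrite in_cons negb_or => /andP[ne_xy x_r]; rewrite IHr // andbT /T' Tyz.
  rewrite eq_sym ne_xy; move: x_r; rewrite in_cons negb_or => /andP[ne_xz _].
  by rewrite eq_sym.
(* [T'] is [T] with the vertex [x] deleted. *)
have conn : connect T' b c.
  apply: (@connect_trans _ _ (last b p)).
    by apply/connectP; exists p; rewrite ?avoid.
  rewrite (sym_connect_sym symT') eq_last.
  by apply/connectP; exists q; rewrite ?avoid.
have /connectP[r0 Pr0 c_last0] := conn.
case/shortenP: Pr0 c_last0 => r Pr Ur _ c_last {r0}.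
have PrT : path T b r by apply: sub_path Pr => y z /and3P[].
have x_r : x \notin b :: r.
  rewrite in_cons negb_or; apply/andP; split.
    by move: x_p; rewrite in_cons negb_or => /andP[].
  by elim: (r) (b) Pr => //= z s IHs y /andP[/and3P[_ _ ne_zx]] /IHs;
     rewrite in_cons negb_or eq_sym ne_zx.
have /acycT : ucycle T (x :: b :: r).
  rewrite /ucycle cons_uniq x_r Ur andbT /= rcons_path Txb PrT /= -c_last.
  by rewrite symT Txc.
by case: r c_last {Pr Ur PrT x_r} => //= cb; rewrite cb eqxx in ne_bc.
Qed.

Section BipartiteWalks.

Variable H : hypergraph.

Lemma last_bip_walk (v : vert H) s :
  last (inl v) (bip_walk (v, s)) = inl (last v (unzip2 s)) :> vert H + edge H.
Proof.
by elim: s v => //= -[e w] s IHs v; apply: IHs.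
Qed.

Lemma bip_walk_inj (v : vert H) s1 s2 :
  bip_walk (v, s1) = bip_walk (v, s2) -> s1 = s2.
Proof.
elim: s1 s2 => [|[e w] s1 IHs] [|[f x] s2] //= [-> -> eq_s].
by rewrite (IHs s2).
Qed.

(** A path of the bipartite graph alternates between vertices and edges; the
    induction on the length consumes two steps at a time. *)
Lemma bip_walk_of_path (T : rel (vert H + edge H)) (v w : vert H) p :
    subrel T (@bip_graph H) -> path T (inl v) p -> last (inl v) p = inl w ->
  exists s, [/\ p = bip_walk (v, s), is_path_from v s & last v (unzip2 s) = w].
Proof.
move=> subT; have [n] := ubnP (size p); elim: n p v => // n IHn.
move=> [|x [|y p]] v /= lt_pn; first by move=> _ [->]; exists [::].
  by case/andP=> /subT; case: x => // ? _ _ [].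
case/and3P=> /subT; case: x => // e v_e /subT; case: y => // u u_e Pp p_last.
have [|s [-> Ps s_last]] := IHn p u _ Pp p_last; first exact: ltnW.
by exists ((e, u) :: s); split=> //=; apply/and3P; split.
Qed.

Lemma tree_path_exists (T : rel (vert H + edge H)) (v w : vert H) :
    subrel T (@bip_graph H) -> connect T (inl v) (inl w) ->
  exists P : walk H, [/\ is_tree_path T P, source P = v & target P = w].
Proof.
move=> subT /connectP[p0 Pp0 p_last0].
case/shortenP: Pp0 p_last0 => p Pp Up _ p_last.
have [s [pE Ps s_last]] := bip_walk_of_path subT Pp (esym p_last).
by exists (v, s); split=> //; rewrite /is_tree_path /is_path Ps /= -pE Pp.
Qed.

Lemma tree_path_unique (T : rel (vert H + edge H)) (P Q : walk H) :
    spanning_tree T -> is_tree_path T P -> is_tree_path T Q ->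
  source P = source Q -> target P = target Q -> P = Q.
Proof.
case=> symT _ _ acycT; case: P Q => [v s] [w t] /and3P[_ PP UP] /and3P[_ PQ UQ].
rewrite /source /target /= in PP UP PQ UQ * => vw; rewrite -vw in PQ UQ * => eq_last.
congr pair; apply: (@bip_walk_inj v).
by apply: (acyclic_uniq_path symT acycT PP PQ UP UQ); rewrite !last_bip_walk eq_last.
Qed.

End BipartiteWalks.

Section Covering.

Variables (gT : finGroupType) (Y X : hypergraph).
Variables (a : haction gT Y) (pi : hmor Y X).
Hypothesis cov : is_free_galois_covering a pi.

Local Notation proj := (fun ev : edge Y * vert Y => (mE pi ev.1, mV pi ev.2)).
Local Notation gact g :=
  (fun ev : edge Y * vert Y => (actE a g ev.1, actV a g ev.2)).

Lemma cover_mV_act g v : mV pi (actV a g v) = mV pi v.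
Proof.
case: cov => _ [theta [[eta [thK _ _ _]] thV _]] _.
by apply: (can_inj thK); rewrite !thV qprojV_act.
Qed.

Lemma cover_mE_act g e : mE pi (actE a g e) = mE pi e.
Proof.
case: cov => _ [theta [[eta [_ _ thK _]] _ thE]] _.
apply: (can_inj thK); rewrite !thE; apply: val_inj; apply/setP=> f /=.
apply/imsetP/imsetP => -[h _ ->].
  by exists (h * g)%g; rewrite // actEM.
by exists (h * g^-1)%g; rewrite // -actEM mulgKV.
Qed.

Lemma cover_vert_fibre v w : mV pi v = mV pi w -> exists g, w = actV a g v.
Proof.
case: cov => _ [theta [_ thV _]] _ eq_vw.
have /(congr1 val)/= /setP/(_ w) : qprojV a v = qprojV a w by rewrite -!thV eq_vw.
rewrite [RHS](_ : _ = true); first by case/imsetP=> g _ ->; exists g.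
by apply/imsetP; exists 1%g; rewrite ?actV1.
Qed.

Lemma cover_edge_fibre e f : mE pi e = mE pi f -> exists g, f = actE a g e.
Proof.
case: cov => _ [theta [_ _ thE]] _ eq_ef.
have /(congr1 val)/= /setP/(_ f) : qprojE a e = qprojE a f by rewrite -!thE eq_ef.
rewrite [RHS](_ : _ = true); first by case/imsetP=> g _ ->; exists g.
by apply/imsetP; exists 1%g; rewrite ?actE1.
Qed.

Lemma cover_vert_free g v : actV a g v = v -> g = 1%g.
Proof. by case: cov => -[freeV _ _] _ _; apply: freeV. Qed.

Lemma cover_edge_surj f : exists e, mE pi e = f.
Proof.
case: cov => _ [theta [[eta [_ _ thK _]] _ thE]] _.
have [e Ee] := qprojE_surj (mE theta f); exists e.
by apply: (can_inj thK); rewrite thE.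
Qed.

Lemma cover_lift_vert e w :
  w \in eset (mE pi e) -> exists2 v, v \in eset e & mV pi v = w.
Proof.
case: cov => _ [theta [[eta [thK _ _ _]] thV thE]] _ /(mor_inc theta).
rewrite thE /= qesetE => /imsetP[v v_e thw]; exists v => //.
by apply: (can_inj thK); rewrite thV.
Qed.

Lemma cover_lift_edge v f :
  mV pi v \in eset f -> exists2 e, v \in eset e & mE pi e = f.
Proof.
have [e <-] := cover_edge_surj f; case/cover_lift_vert=> w w_e.
case/cover_vert_fibre=> g ->; exists (actE a g e); last exact: cover_mE_act.
exact: act_inc.
Qed.

(** If [f = g e] contains [v], then [v] and [g^-1 v] both lie in [e], which
    freeness excludes for [g != 1].  This and [cover_vert_unique] are the
    uniqueness of path lifting. *)
Lemma cover_edge_unique v e f :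
  v \in eset e -> v \in eset f -> mE pi e = mE pi f -> e = f.
Proof.
case: cov => -[_ _ freeB] _ _ v_e v_f /cover_edge_fibre[g fE].
have [g1|ne_g1] := eqVneq g 1%g; first by rewrite fE g1 actE1.
have := freeB g^-1%g v e v_e; rewrite fE in v_f.
have := act_inc a g^-1%g v_f; rewrite -actEM mulVg actE1 => -> H.
have /H // : g^-1%g <> 1%g by move/eqP; rewrite invg_eq1 (negPf ne_g1).
Qed.

Lemma cover_vert_unique e v w :
  v \in eset e -> w \in eset e -> mV pi v = mV pi w -> v = w.
Proof.
case: cov => -[_ _ freeB] _ _ v_e w_e /cover_vert_fibre[g wE].
have [g1|/eqP ne_g1] := eqVneq g 1%g; first by rewrite wE g1 actV1.
by have := freeB g v e v_e ne_g1; rewrite -wE w_e.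
Qed.

Lemma path_lift y s : is_path_from (mV pi y) s ->
  exists s', is_path_from y s' /\ map proj s' = s.
Proof.
elim: s y => [|[e w] s IHs] y /=; first by exists [::].
case/and3P=> /cover_lift_edge[e' y_e' <-] /cover_lift_vert[w' w_e' <-].
case/IHs=> s' [Ps' <-]; exists ((e', w') :: s'); split=> //=.
by rewrite y_e' w_e'.
Qed.

Lemma path_lift_unique y s1 s2 : is_path_from y s1 -> is_path_from y s2 ->
  map proj s1 = map proj s2 -> s1 = s2.
Proof.
elim: s1 y s2 => [|[e v] s1 IHs] y [|[f w] s2] //=.
case/and3P=> ye ve Ps1 /and3P[yf wf Ps2] [ef vw eq_s].
have {}ef := cover_edge_unique ye yf ef; rewrite -ef in wf *.
have {}vw := cover_vert_unique ve wf vw; rewrite -vw in Ps2 *.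
by rewrite (IHs v s2).
Qed.

Lemma is_path_from_act g y s :
  is_path_from y s -> is_path_from (actV a g y) (map (gact g) s).
Proof.
elim: s y => //= -[e w] s IHs y /and3P[ye we /IHs Ps].
by rewrite /= Ps !act_inc.
Qed.

Lemma map_proj_act g s : map proj (map (gact g) s) = map proj s.
Proof.
rewrite -map_comp; apply: eq_map => -[e v] /=.
by rewrite cover_mV_act cover_mE_act.
Qed.

Lemma last_act g y s :
  last (actV a g y) (unzip2 (map (gact g) s)) = actV a g (last y (unzip2 s)).
Proof. by elim: s y => //= -[e w] s IHs y; apply: IHs. Qed.

Lemma last_proj y s :
  last (mV pi y) (unzip2 (map proj s)) = mV pi (last y (unzip2 s)).
Proof. by elim: s y => //= -[e w] s IHs y; apply: IHs. Qed.

End Covering.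

(** * Frobenius elements and closed lifts *)

Section Frobenius.

Variables (gT : finGroupType) (Y X : hypergraph).
Variables (a : haction gT Y) (pi : hmor Y X).
Hypothesis cov : is_free_galois_covering a pi.
Variables (T : rel (vert X + edge X)) (y0 : vert Y).
Hypothesis treeT : spanning_tree T.

Local Notation proj := (fun ev : edge Y * vert Y => (mE pi ev.1, mV pi ev.2)).
Local Notation gact g :=
  (fun ev : edge Y * vert Y => (actE a g ev.1, actV a g ev.2)).
Local Notation sheet := (sheet_id pi T y0).

(** The sheet of the identity meets each fibre in exactly one point, since the
    tree path to a given vertex exists and is unique, and so is its lift. *)
Lemma sheet_exists w : exists2 s, s \in sheet & mV pi s = w.
Proof.
have [symT subT connT _] := treeT.
have [[v p] [treeP /= vE p_last]] :=
  tree_path_exists subT (connT (inl (mV pi y0)) (inl w)).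
have := treeP; rewrite /source /= in vE; rewrite vE in treeP p_last *.
case/and3P=> /(path_lift cov)/= [p' [Pp' p'E]] _ _.
exists (last y0 (unzip2 p')); last by rewrite -last_proj p'E -p_last.
rewrite inE; apply/asboolP; exists (mV pi y0, p), (y0, p'); split=> //.
by split=> //; rewrite /map_walk /= p'E.
Qed.

Lemma sheet_unique s t : s \in sheet -> t \in sheet -> mV pi s = mV pi t -> s = t.
Proof.
rewrite !inE => /asboolP[P [[x p] [treeP Py0 [Pp pE] xE <-]]].
case/asboolP=> Q [[z q] [treeQ Qy0 [Pq qE] zE <-]] eq_pi.
rewrite /source /= in xE zE; rewrite xE zE in Pp pE Pq qE eq_pi *.
have PQ : P = Q.
  apply: (tree_path_unique treeT treeP treeQ); first by rewrite Py0.
  by rewrite -pE -qE /target /= !last_proj.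
congr target; congr pair; apply: (path_lift_unique cov Pp Pq).
by have := etrans pE (etrans PQ (esym qE)) => -[].
Qed.

Lemma actV_inj_group s g h : actV a g s = actV a h s -> g = h.
Proof.
move=> eq_gh; apply/eqP; rewrite eq_mulgV1 -invg_eq1 invMg invgK; apply/eqP.
have := @cover_vert_free _ _ _ _ _ cov (h * g^-1)%g (actV a g s).
apply; rewrite -actVM mulgKV; exact: esym.
Qed.

Lemma sheet_numberE g s : s \in sheet -> sheet_number a pi T y0 (actV a g s) = g.
Proof.
move=> s_sh; rewrite /sheet_number; case: pickP => [h|/(_ g)] /=; last first.
  by move/exists_inP=> []; exists s.
case/exists_inP=> t t_sh /eqP eq_gh.
have st : s = t.
  apply: sheet_unique => //.
  by rewrite -(cover_mV_act cov g s) eq_gh (cover_mV_act cov).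
by rewrite -st in eq_gh; apply/esym/(actV_inj_group eq_gh).
Qed.

(** The lift of a closed path [C] from the point [s] of the sheet ends in the
    fibre of [s], at [g s] say; as [s] is the only point of the sheet in that
    fibre, [g] is its sheet number. *)
Lemma frobeniusP (C : walk X) : is_path C -> C.1 = target C ->
  exists s s', [/\ mV pi s = C.1, is_path_from s s', map proj s' = C.2
    & last s (unzip2 s') = actV a (frobenius a pi T y0 C) s].
Proof.
case: C => v c; rewrite /is_path /target /= => Pc vE.
have [s s_sh sv] := sheet_exists v; rewrite -sv in Pc vE *.
have [s' [Ps' s'E]] := path_lift cov Pc; exists s, s'; split=> //.
have [g gE] : exists g, last s (unzip2 s') = actV a g s.
  by apply: (cover_vert_fibre cov); rewrite -last_proj s'E.
rewrite gE; congr actV; rewrite /frobenius.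
case: pickP => [h /asboolP[[t t'] [[Pt tE] /= t_sh h_num]]|/(_ g)/asboolP[]].
  case: tE => tv t'E; rewrite /source /= in t_sh Pt.
  have ts : t = s by apply: sheet_unique => //; rewrite tv.
  rewrite ts /is_path /= in Pt.
  have t's' : t' = s' by apply: (path_lift_unique cov Pt Ps'); rewrite t'E.
  by rewrite -h_num /target /= ts t's' gE sheet_numberE.
exists (s, s'); split=> //=; last by rewrite /target /= gE sheet_numberE.
by split=> //; rewrite /map_walk /= s'E.
Qed.

(** The lift of [C^(k+1)] is the lift of [C] followed by the translate by [h] of
    the lift of [C^k]. *)
Lemma lift_word_pow s s' h k :
    is_path_from s s' -> last s (unzip2 s') = actV a h s ->
  exists q, [/\ is_path_from s q, map proj q = word_pow k (map proj s')
    & last s (unzip2 q) = actV a (h ^+ k)%g s].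
Proof.
move=> Ps' s'_last; elim: k => [|k [q [Pq qE q_last]]].
  by exists [::]; rewrite expg0 actV1.
exists (s' ++ map (gact h) q); split.
- by rewrite is_path_from_cat Ps' s'_last is_path_from_act.
- by rewrite map_cat (map_proj_act cov) qE.
by rewrite /unzip2 map_cat last_cat s'_last last_act q_last expgS actVM.
Qed.

Definition closed_lifts m (s : seq (edge X * vert X)) :
    {set m.-tuple (edge Y * vert Y)} :=
  [set t : m.-tuple (edge Y * vert Y)
    | path.cycle (@step Y) t && (map proj t == s)].

(** In a closed walk each letter has a predecessor, which puts its vertex on its
    edge; the relation [step] itself only speaks of the next edge. *)
Lemma cycle_step_inc (H : hypergraph) (t : seq (edge H * vert H)) :
  path.cycle (@step H) t -> all (fun x => x.2 \in eset x.1) t.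
Proof.
have inc y s : path (@step H) y s -> all (fun x => x.2 \in eset x.1) s.
  by elim: s y => //= z s IHs y /andP[/and4P[_ -> _ _] /IHs].
by case: t => // x t /inc; rewrite all_rcons.
Qed.

(** Two distinct vertices of one edge, or two distinct edges through one vertex,
    have distinct images by freeness. *)
Lemma cycle_step_proj t :
  path.cycle (@step Y) t -> path.cycle (@step X) (map proj t).
Proof.
move=> cyc_t; rewrite cycle_map.
apply: (sub_in_cycle _ (cycle_step_inc cyc_t) cyc_t) => -[e v] [f w] v_e _.
rewrite /step /= in v_e *; case/and4P=> vf wf ne_vw ne_ef; rewrite !mor_inc //=.
apply/andP; split; [move: ne_vw | move: ne_ef]; apply: contra => /eqP eq_pi.
  exact/eqP/(cover_vert_unique cov vf wf).
exact/eqP/(cover_edge_unique cov v_e vf).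
Qed.

Lemma cycle_step_lift y t : y = last y (unzip2 t) -> is_path_from y t ->
  path.cycle (@step X) (map proj t) -> path.cycle (@step Y) t.
Proof.
have [->//|t0] := eqVneq t [::]; move=> yE Pt.
rewrite (cycle_stepE t0 yE) Pt (@cycle_stepE X (mV pi y)) //; last first.
- by rewrite last_proj -yE.
- by rewrite -size_eq0 size_map size_eq0.
case/and4P=> _; rewrite -map_cat.
have unzip2_proj u : unzip2 (map proj u) = map (mV pi) (unzip2 u).
  by rewrite /unzip2 -!map_comp.
have unzip1_proj u : unzip1 (map proj u) = map (mE pi) (unzip1 u).
  by rewrite /unzip1 -!map_comp.
have sorted_lift (U V : eqType) (f : U -> V) u :
    sorted (fun x y => x != y) (map f u) -> sorted (fun x y => x != y) u.
  by rewrite sorted_map; apply: sub_sorted => x z; apply: contra => /eqP ->.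
rewrite unzip2_proj !unzip1_proj => distV distE distE2.
apply/and4P; split=> //.
- exact: (@sorted_lift _ _ (mV pi) (y :: unzip2 t)).
- exact: sorted_lift distE.
- exact: sorted_lift distE2.
Qed.

(** The lifts of [C^k] are the translates [g q], for [g] in the group, of the
    lift [q] starting in the sheet of the identity; [g q] runs from [g s] to
    [g F(C)^k s]. *)
Lemma card_closed_lifts (C : walk X) k m :
    is_path C -> path.cycle (@step X) C.2 -> C.2 != [::] -> C.1 = target C ->
    (0 < k)%N -> m = (k * size C.2)%N ->
  #|closed_lifts m (word_pow k C.2)|
    = if (frobenius a pi T y0 C ^+ k == 1)%g then #|gT| else 0%N.
Proof.
move=> PC cycC C0 C_closed k_gt0 mE.
have [s [s' [sC Ps' s'E s'_last]]] := frobeniusP PC C_closed.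
move: (frobenius _ _ _ _ _) s'_last => h s'_last.
have [q [Pq qE q_last]] := lift_word_pow k Ps' s'_last; rewrite s'E in qE.
have size_q : size q = m by rewrite -(size_map proj) qE size_word_pow.
have m_gt0 : (0 < m)%N by rewrite mE muln_gt0 k_gt0 lt0n size_eq0.
have size_gq g : size (map (gact g) q) == m by rewrite size_map size_q.
have last_q g : last (actV a g s) (unzip2 (map (gact g) q))
    = actV a (g * h ^+ k)%g s by rewrite last_act q_last actVM.
(* A closed lift starts at some [g s], so it is [g q], and it closes up. *)
have lifts t : t \in closed_lifts m (word_pow k C.2) ->
    (h ^+ k == 1)%g /\ exists g, t = Tuple (size_gq g).
  rewrite inE => /andP[cyc_t /eqP tE].
  have t0 : tval t != [::] by rewrite -size_eq0 size_tuple -lt0n.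
  pose y := last s (unzip2 t).
  have yE : y = last y (unzip2 t).
    apply: last_default => /(congr1 size)/eqP.
    by rewrite size_map size_eq0 (negPf t0).
  have := cyc_t; rewrite (cycle_stepE t0 yE) => /and4P[Pt _ _ _].
  have [g gE] : exists g, y = actV a g s.
    apply: (cover_vert_fibre cov); rewrite /y -last_proj tE -qE last_proj q_last.
    by rewrite (cover_mV_act cov).
  have tq : tval t = map (gact g) q.
    apply: (path_lift_unique cov Pt); rewrite ?gE ?is_path_from_act //.
    by rewrite (map_proj_act cov) qE.
  split; last by exists g; apply: val_inj.
  move: yE; rewrite tq gE last_q -{1}[g]mulg1 => /actV_inj_group/mulgI <-.
  exact: eqxx.
case: eqP => [hk1|/eqP nhk1]; last first.
  by apply: eq_card0 => t; apply/negP => /lifts[]; rewrite (negPf nhk1).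
rewrite -(card_imset gT (f := fun g => Tuple (size_gq g))).
  apply: eq_card => t; apply/idP/imsetP => [/lifts[_ [g ->]]|[g _ ->]].
    by exists g.
  rewrite inE /= (map_proj_act cov) qE eqxx andbT.
  apply: (@cycle_step_lift (actV a g s)).
  - by rewrite last_q hk1 mulg1.
  - exact: is_path_from_act.
  by rewrite (map_proj_act cov) qE cycle_step_word_pow.
move=> g g' /(congr1 val)/= eq_gg; apply: (@actV_inj_group s).
have := last_q g; have := last_q g'; rewrite hk1 !mulg1 => <- <-; rewrite -eq_gg.
apply: last_default => /(congr1 size)/eqP.
by rewrite size_map size_map size_q (gtn_eqF m_gt0).
Qed.

Lemma card_closed_lifts_rot m k s :
  #|closed_lifts m (rot k s)| = #|closed_lifts m s|.
Proof.
rewrite -(card_imset (closed_lifts m s) (f := fun t : m.-tuple _ => [tuple of rot k t])).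
  apply: eq_card => t; rewrite inE; apply/andP/imsetP => [[cyc_t /eqP tE]|[u]].
    exists [tuple of rotr k t]; last by apply: val_inj; rewrite /= rotrK.
    by rewrite inE /= rotr_cycle cyc_t map_rotr tE rotK /=.
  by rewrite inE => /andP[? /eqP <-] ->; rewrite /= rot_cycle map_rot.
by move=> t u /(congr1 val) /rot_inj /val_inj.
Qed.

Lemma sum_closed_lifts m :
  #|[set t : m.-tuple (edge Y * vert Y) | path.cycle (@step Y) t]| =
  (\sum_(s : m.-tuple (edge X * vert X) | path.cycle (@step X) s)
     #|closed_lifts m s|)%N.
Proof.
rewrite -sum1_card (partition_big (fun t : m.-tuple _ => [tuple of map proj t])
  (fun s : m.-tuple _ => path.cycle (@step X) s)) /= => [|t].
  apply: eq_bigr => s _; rewrite -sum1_card; apply: eq_bigl => t.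
  by rewrite !inE -val_eqE.
by rewrite inE => /cycle_step_proj.
Qed.

End Frobenius.

(** * Traces and L-functions *)

Section Representations.

Lemma repr_mx_pow (K : fieldType) (gT : finGroupType) (n : nat)
    (rho : mx_representation K [set: gT] n) (g : gT) (k : nat) :
  rho g ^+ k = rho (g ^+ k)%g.
Proof.
elim: k => [|k IHk]; first by rewrite expr0 expg0 repr_mx1.
by rewrite exprS expgS repr_mxM ?inE // IHk.
Qed.

Lemma mxtrace_regular_repr (K : fieldType) (gT : finGroupType) (g : gT) :
  \tr (regular_repr K [set: gT]%G g)
    = (if (g == 1)%g then #|gT| else 0%N)%:R.
Proof.
rewrite /mxtrace /=; case: eqP => [->|ne_g1].
  under eq_bigr => i _ do rewrite mxE mulg1 gring_valK mxE !eqxx.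
  by rewrite sumr_const card_ord /gcard cardsT.
apply: big1 => i _; rewrite !mxE /= [_ == _](_ : _ = false) //.
apply/eqP=> /(congr1 enum_val); rewrite gring_indexK ?inE //.
by rewrite -{1}[enum_val i]mulg1 => /mulgI/esym.
Qed.

(** A complete family of irreducible representations is in bijection, up to
    similarity, with the simple components of the regular representation. *)
Lemma mxtrace_complete_irreducibles (K : closedFieldType) (gT : finGroupType)
    (I : finType) (d : I -> nat)
    (rho : forall i, mx_representation K [set: gT] (d i)) (g : gT) :
    [pchar K] =i pred0 -> complete_irreducibles rho ->
  \sum_(i : I) \tr (rho i g) *+ d i = \tr (regular_repr K [set: gT]%G g).
Proof.
move=> charK [irr_rho rsim_rho all_rho].
have splitG : group_splitting_field K [set: gT]%G.
  exact: group_closure_closed_field.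
have K'G : pgroup.pgroup [pchar K]^' [set: gT].
  rewrite /pgroup.pgroup; apply/pnatP => [|p _ _]; first exact: cardG_gt0.
  by rewrite inE /= charK.
pose sG : irrType K [set: gT]%G := DecSocleType _.
rewrite (mxtrace_regular_pchar sG K'G splitG) ?inE //.
have rsim i := rsim_irr_comp_pchar sG K'G (irr_rho i).
pose f i := irr_comp sG (rho i).
have f_inj : injective f.
  move=> i j eq_f; apply: rsim_rho; apply: mx_rsim_trans (rsim i) _.
  by rewrite -/(f i) eq_f; apply: mx_rsim_sym.
have f_surj W : W \in codom f.
  have [i rsimW] := all_rho _ _ (socle_irr W).
  rewrite -(irr_reprK_pchar K'G W) (irr_comp_rsim_pchar sG K'G rsimW).
  exact: codom_f.
rewrite (reindex f) /=; last first.
  apply/onW_bij/inj_card_bij => //; rewrite -(card_codom f_inj).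
  exact/subset_leq_card/subsetP.
apply: eq_bigr => i _; rewrite (mxtrace_rsim (rsim i)) ?inE //.
congr (_ *+ _); by case: (rsim i).
Qed.

End Representations.

Section LogDerivatives.

Variable K : fieldType.
Hypothesis charK : [pchar K] =i pred0.

(** The logarithmic derivative of a product over the classes of prime cycles [C]
    whose factors have logarithmic derivative [sum_k l * c_l(k, C) u^(l k)]. *)
Definition prime_trace_series (H : hypergraph)
    (c : forall l, nat -> lwalk H l -> K) : fps K :=
  Fps (fun m => \sum_(l < m.+1 | (0 < l)%N && (l %| m)%N)
    \sum_(C in transversal (prime_classes H l) (prime_cycles H l))
       c l (m %/ l)%N C *+ l).

Lemma prime_cycles0 (H : hypergraph) : prime_cycles H 0 = set0.
Proof.
apply/setP=> -[v t]; rewrite mem_prime_cycles [in RHS]inE.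
by rewrite (tuple0 t) /= /primitive /=.
Qed.

Lemma has_logder_prime_product (H : hypergraph)
    (F : forall l, lwalk H l -> fps K) (c : forall l, nat -> lwalk H l -> K) :
    (forall l C, (0 < l)%N -> has_logder (F l C)
       (Fps (fun m => if (0 < m)%N && (l %| m)%N
                      then c l (m %/ l)%N C *+ l else 0))) ->
  has_logder (fps_prod (fun l =>
      \prod_(C in transversal (prime_classes H l) (prime_cycles H l)) F l C))
    (prime_trace_series c).
Proof.
move=> FP.
pose h l (C : lwalk H l) : fps K :=
  Fps (fun m => if (0 < m)%N && (l %| m)%N then c l (m %/ l)%N C *+ l else 0).
pose X l := transversal (prime_classes H l) (prime_cycles H l).
have X0 C : C \in X 0%N -> False.
  move=> /(subsetP (transversal_sub (transversalP (prime_classes_partition H 0)))).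
  by rewrite prime_cycles0 inE.
have hP l : has_logder (\prod_(C in X l) F l C) (\sum_(C in X l) h l C).
  by apply: has_logder_prod => C CX; apply: FP; case: l C CX => // C /X0.
have := has_logder_fps_prod charK hP.
set s := Fps _; set s' := prime_trace_series c => sP.
suff <- : s = s'.
  apply: sP => l m lt_ml; rewrite coef_fps_sum big1 // => C _ /=.
  by case: m lt_ml => // m lt_ml; rewrite gtnNdvd.
apply: fpsP => m; rewrite /= [RHS]big_mkcond; apply: eq_bigr => l _.
rewrite coef_fps_sum; have [l0|l_gt0] := posnP l.
  by rewrite big1 // => C; case: (l : nat) l0 C => // _ C /X0.
have m_gt0 : (0 < m)%N by rewrite (leq_trans l_gt0) // -ltnS.
have hE C : h l C m = if (l %| m)%N then c l (m %/ l)%N C *+ l else 0.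
  by rewrite /h /= m_gt0.
rewrite (eq_bigr _ (fun C _ => hE C)).
by case: (l %| m)%N => //=; rewrite big1.
Qed.

Lemma has_logder_zeta (H : hypergraph) :
  has_logder (zeta K H) (Fps (fun m => if m == 0%N then 0 else
    #|[set t : m.-tuple (edge H * vert H) | path.cycle (@step H) t]|%:R)).
Proof.
have := @has_logder_prime_product H (fun l _ => (1 - fpsX K ^+ l)^-1)
  (fun l m C => 1).
set s := prime_trace_series _; set s' := Fps _.
have <- : s = s'.
  apply: fpsP => m; rewrite /=; have [->|m_gt0] := posnP m.
    by rewrite big1 // => -[[|l] ltl].
  rewrite -sum1_card natr_sum.
  have := @sum_cyclic_words H K m (fun => 1) m_gt0 (fun _ _ => erefl).
  move=> <-; apply: eq_bigl => t; by rewrite inE.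
move=> logP; rewrite /zeta.
have -> : (fun l => \prod_(c in prime_classes H l) (1 - fpsX K ^+ l)^-1)
  = (fun l => \prod_(C in transversal (prime_classes H l) (prime_cycles H l))
         (1 - fpsX K ^+ l)^-1).
  by apply: funext => l; rewrite !prodr_const card_prime_transversal.
apply: logP => l _ l_gt0; have := has_logder_det_inv (1%:M : 'M[K]_1) l_gt0.
rewrite det_mx11 !mxE /= !mulr1n.
have -> : fpsC (1 : K) = 1 by []; rewrite mulr1.
set u := Fps _; set u' := Fps _; suff -> : u = u' by [].
by apply: fpsP => m /=; rewrite expr1n mxtrace1.
Qed.

Section Lfunctions.

Variables (gT : finGroupType) (Y X : hypergraph).
Variables (a : haction gT Y) (pi : hmor Y X).
Hypothesis cov : is_free_galois_covering a pi.
Variables (T : rel (vert X + edge X)) (y0 : vert Y).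
Hypothesis treeT : spanning_tree T.

Local Notation frob C := (frobenius a pi T y0 (walk_of C)).

Lemma has_logder_Lfun n (rho : mx_representation K [set: gT] n) :
  has_logder (Lfun a pi T y0 rho)
    (@prime_trace_series X (fun l k C => \tr (rho (frob C ^+ k)%g))).
Proof.
apply: has_logder_prime_product => l C l_gt0.
have := has_logder_det_inv (rho (frob C)) l_gt0.
set u := Fps _; set u' := Fps _; suff -> : u = u' by [].
by apply: fpsP => m /=; rewrite repr_mx_pow.
Qed.

(** The trace of the regular representation at [F(C)^k] is the number of closed
    lifts of [C^k], a function of the word [C^k] that is invariant under
    rotation. *)
Lemma regular_prime_trace_series :
  @prime_trace_series X
      (fun l k C => \tr (regular_repr K [set: gT]%G (frob C ^+ k)%g))
  = Fps (fun m => if m == 0%N then 0 else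
      #|[set t : m.-tuple (edge Y * vert Y) | path.cycle (@step Y) t]|%:R).
Proof.
apply: fpsP => m; rewrite /=; have [->|m_gt0] := posnP m.
  by rewrite big1 // => -[[|l] ltl].
rewrite (sum_closed_lifts cov) natr_sum.
rewrite (sum_cyclic_words (w := fun s => #|closed_lifts pi m s|%:R)) //; last first.
  by move=> k s; rewrite card_closed_lifts_rot.
apply: eq_bigr => l /andP[l_gt0 l_dvd]; apply: eq_bigr => C CX.
have CP : C \in prime_cycles X l.
  exact: subsetP (transversal_sub (transversalP (prime_classes_partition X l))) C CX.
have := CP; rewrite mem_prime_cycles => /and3P[cycC primC /eqP Cv].
have PC : is_path (walk_of C).
  by move: CP; rewrite inE => /asboolP[/and3P[]].
have [C0 _] := andP primC.
rewrite mxtrace_regular_repr.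
rewrite (card_closed_lifts cov y0 treeT PC cycC C0 Cv) //.
  by rewrite divn_gt0 // dvdn_leq.
by rewrite /= size_tuple divnK.
Qed.

Lemma Lfun_regular : Lfun a pi T y0 (regular_repr K [set: gT]%G) = zeta K Y.
Proof.
have := has_logder_Lfun (regular_repr K [set: gT]%G).
rewrite regular_prime_trace_series => /(has_logder_inj charK); apply.
exact: has_logder_zeta.
Qed.

End Lfunctions.

End LogDerivatives.

Lemma zeta_prod_Lfun (K : closedFieldType) (gT : finGroupType)
    (Y X : hypergraph)
    (a : haction gT Y) (pi : hmor Y X) (T : rel (vert X + edge X)) (y0 : vert Y)
    (I : finType) (d : I -> nat)
    (rho : forall i, mx_representation K [set: gT] (d i)) :
    [pchar K] =i pred0 -> complete_irreducibles rho ->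
  \prod_(i : I) Lfun a pi T y0 (rho i) ^+ d i
    = Lfun a pi T y0 (regular_repr K [set: gT]%G).
Proof.
move=> charK irr_rho.
have logP := has_logder_prod (index_enum I) (fun i (_ : true) =>
  has_logderX (d i) (has_logder_Lfun charK a pi T y0 (rho i))).
have := has_logder_inj charK logP; apply.
set u := \sum_(i : I) _.
suff -> : u = prime_trace_series (fun l k C =>
    \tr (regular_repr K [set: gT]%G (frobenius a pi T y0 (walk_of C) ^+ k)%g)).
  exact: has_logder_Lfun.
apply: fpsP => m; rewrite coef_fps_sum.
under eq_bigr => i _ do rewrite coef_fpsMn /= -sumrMnl.
rewrite exchange_big; apply: eq_bigr => l _ /=.
under eq_bigr => i _ do rewrite -sumrMnl.
rewrite exchange_big; apply: eq_bigr => C _ /=.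
rewrite -(mxtrace_complete_irreducibles _ charK irr_rho) -sumrMnl.
by apply: eq_bigr => i _; rewrite mulrnAC.
Qed.

Theorem theoremB (R : realType) (gT : finGroupType) (Y X : hypergraph)
    (a : haction gT Y) (pi : hmor Y X) :
  connected Y ->
  is_free_galois_covering a pi ->
  forall (T : rel (vert X + edge X)) (y0 : vert Y),
  spanning_tree T ->
  (forall (I : finType) (d : I -> nat)
      (rho : forall i, mx_representation R[i] [set: gT] (d i)),
    complete_irreducibles rho ->
    zeta R[i] Y = \prod_(i : I) Lfun a pi T y0 (rho i) ^+ d i)
  /\ Lfun a pi T y0 (regular_repr R[i] [set: gT]%G) = zeta R[i] Y.
Proof.
move=> _ cov T y0 treeT; have charC : [pchar R[i]] =i pred0.
  exact: Num.Theory.pchar_num.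
have reg := Lfun_regular charC cov y0 treeT.
split=> // I d rho irr_rho; rewrite -reg; apply/esym.
exact: (zeta_prod_Lfun a pi T y0 charC irr_rho).
Qed.
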